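(* Let $f:\{0,1\}^{\mathbb N}\to\mathbb R$ be a Lipschitz function for which there exist negative numbers $b,d,\{a_n\}_{n\ge2},\{c_n\}_{n\ge2}$ such that, for $n\ge2$, $$f|_{[01]}=b,\quad f|_{[10]}=d,\quad f(0^\infty)=f(1^\infty)=0,\quad f|_{[0^n1]}=a_n,\quad f|_{[1^n0]}=c_n,$$ and for $\beta>0$ let $\mu_\beta$ be the equilibrium measure of $\beta f$. Suppose $\sum_{j\ge2}a_j\ge b+d+\sum_{j\ge2}c_j$ and $\sum_{j\ge2}c_j\ge b+d+\sum_{j\ge2}a_j$. Then $(\mu_\beta)_{\beta>0}$ satisfies a large deviation principle with deviation function $I(x)=R_+^\infty(x)$. More precisely, $$I(0^\infty)=0,\qquad I(1^\infty)=0,$$ and for any $x\in\{0,1\}^{\mathbb N}$, $$I(x)=\begin{cases}R_+^n(x)&\text{if }x=(x_1\dots x_n0^\infty)\text{ or }x=(x_1\dots x_n1^\infty),\\ +\infty&\text{else,}\end{cases}$$ where $R_+=-f-U+U\circ\sigma$ and $U:\{0,1\}^{\mathbb N}\to\mathbb R$ satisfies, for all $q\ge1$ and $z\in\{0,1\}^{\mathbb N}$, $$U(0^\infty)=0,$$ $$U(1^\infty)=\frac b2-\frac d2+\frac12\sum_{j\ge2}a_j-\frac12\sum_{j\ge2}c_j,$$ $$U(0^q1z)=\sum_{j\ge1}a_{q+j},$$ $$U(1^q0z)=\frac b2-\frac d2+\frac12\sum_{j\ge2}a_j-\frac12\sum_{j\ge2}c_j+\sum_{j\ge1}c_{q+j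}.$$
   Context: $X=\{0,1\}^{\mathbb N}$, $\mathbb N=\{1,2,3,\dots\}$, with the metric $d_\theta(x,y)=\theta^{\min\{i:\,x_i\ne y_i\}}$ for $x\neq y$, $\theta\in(0,1)$ fixed; $\sigma$ is the shift map. A cylinder is a set $[x_1\dots x_n]$ of all points of $X$ starting with the word $x_1\dots x_n$. $0^n$ (resp. $1^n$) is the word of $n$ zeros (resp. ones), $0^\infty=(000\dots)$, $1^\infty=(111\dots)$, and $[0^n1]$, $[1^n0]$ are the corresponding cylinders. $(x_1\dots x_n y)$ denotes concatenation of the word $x_1\dots x_n$ with $y\in X$. The sums $\sum_{j\ge 2}a_j$ and $\sum_{j\ge 2}c_j$ are finite because $f$ is Lipschitz with $f(0^\infty)=f(1^\infty)=0$. The equilibrium measure $\mu_\beta$ of $\beta f$ is the unique $\sigma$-invariant Borel probability attaining $P(\beta f)=\sup_\mu\left(\int\beta f\,d\mu+h(\mu)\right)$, the supremum over $\sigma$-invariant Borel probabilities $\mu$ on $X$, where $h(\mu)$ is the Kolmogorov–Sinai entropy. Large deviation principle: $(\mu_\beta)_{\beta>0}$ satisfies a large deviation principle with deviation function $I$ if $I:X\to[0,+\infty]$ is lower semi-continuous and, for any cylinder $k\subset X$, $\lim_{\beta\to+\infty}\frac1\beta\log(\mu_\beta(k))=-\inf_{x\in k}I(x)$. $R_+^n(x):=\sum_{j=0}^{n-1}R_+(\sigma^j(x))$ and $R_+^\infty(x):=\lim_{n\to+\infty}R_+^n(x)\in[0,+\infty]$ (the function $R_+$ is nonnegative). *)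

(* Defs.v *)
From HB Require Import structures.
From mathcomp Require Import all_boot all_order all_algebra.
From mathcomp Require Import all_classical all_reals all_analysis.

Set Implicit Arguments.
Unset Strict Implicit.
Unset Printing Implicit Defensive.
Import Order.TTheory GRing.Theory Num.Theory.
Import numFieldNormedType.Exports.

Local Open Scope classical_set_scope.
Local Open Scope ring_scope.

(* The coordinate [x i] of a point [x] of the full shift is x_(i+1) in the
   numbering of coordinates by 1, 2, 3, ...; the symbols 0 and 1 are [false]
   and [true]. *)
Definition shift_space : Type := cantor_space.

HB.instance Definition _ := Pointed.on shift_space.
HB.instance Definition _ := Nbhs.on shift_space.
HB.instance Definition _ := Topological.on shift_space.
HB.instance Definition _ := Uniform.on shift_space.
HB.instance Definition _ :=
  @isMeasurable.Build (sigma_display (@open cantor_space)) shift_space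
    <<s @open cantor_space >>
    (@sigma_algebra0 _ setT (@open cantor_space))
    (@sigma_algebraC _ (@open cantor_space))
    (@sigma_algebra_bigcup _ setT (@open cantor_space)).

Definition shift_map (x : shift_space) : shift_space := fun i => x i.+1.

Definition const_point (s : bool) : shift_space := fun=> s.

Definition concat (w : seq bool) (y : shift_space) : shift_space :=
  fun i => if (i < size w)%N then nth false w i else y (i - size w)%N.

Definition cylinder (w : seq bool) : set shift_space :=
  [set x | exists y, x = concat w y].

(* The exponent is shifted by one because coordinates start at 0 here. *)
Definition theta_dist (R : realType) (theta : R) (x y : shift_space) : R :=
  if pselect (exists i, x i != y i) is left h then theta ^+ (ex_minn h).+1
  else 0.

Definition Lipschitz (R : realType) (theta : R) (f : shift_space -> R) : Prop :=
  exists L, forall x y, `|f x - f y| <= L * theta_dist theta x y.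

Lemma theta_dist_lt (R : realType) (theta : R) (x y : shift_space) n :
  0 < theta < 1 ->
  theta_dist theta x y < theta ^+ n <-> (forall i, (i < n)%N -> x i = y i).
Proof.
move=> /andP[t0 t1]; rewrite /theta_dist; case: pselect => [h|nh]; last first.
  rewrite exprn_gt0//; split=> // _ i _.
  by apply/eqP/negPn/negP => xy; apply: nh; exists i.
case: ex_minnP => m xym minm; rewrite ltr_iXn2l// ltnS; split=> [nm i ni|xy].
  apply/eqP/negPn/negP => /minm mi.
  by have := leq_trans ni (leq_trans nm mi); rewrite ltnn.
by rewrite leqNgt; apply/negP => /xy /eqP; rewrite (negbTE xym).
Qed.

(* The topology of [shift_space], which underlies its sigma-algebra and
   semicontinuity below, is the one of the metric [theta_dist theta]. *)
Lemma open_theta_dist (R : realType) (theta : R) (A : set shift_space) :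
  0 < theta < 1 ->
  open A <-> forall x, A x ->
    exists2 e : R, 0 < e & forall y, theta_dist theta x y < e -> A y.
Proof.
move=> t01; have /andP[t0 t1] := t01; split=> [oA x Ax|dA].
  apply: contrapT => /forall2NP nA.
  have /choice[y yP] : forall n, exists y,
      (forall i, (i < n)%N -> x i = y i) /\ ~ A y.
    move=> n; have [|] := nA (theta ^+ n); first by rewrite exprn_gt0.
    move=> /existsNP[y /not_implyP[/(theta_dist_lt _ _ _ t01) xy nAy]].
    by exists y.
  have yx : {ptws, (y : nat -> nat -> bool) @ \oo --> (x : nat -> bool)}.
    apply/pointwise_cvgP => i B xB.
    exists i.+1 => // n /= ni; rewrite -(yP n).1//.
    exact: nbhs_singleton.
  have /yx : nbhs (x : cantor_space) A by exact: open_nbhs_nbhs.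
  by case=> n _ /(_ n (leqnn n)); exact: (yP n).2.
rewrite openE => x /dA[e e0 xeA].
have [n ne] : exists n, theta ^+ n < e.
  have /cvgrPdist_lt/(_ _ e0)[n _ /(_ n (leqnn n))] :
      theta ^+ n @[n --> \oo] --> 0 by apply: cvg_expr; rewrite ger0_norm// ltW.
  by rewrite sub0r normrN ger0_norm ?exprn_ge0 ?ltW//; exists n.
have agree : nbhs (x : cantor_space) [set y | forall i : 'I_n, x i = y i].
  have h : forall i : 'I_n, nbhs (x : cantor_space) [set y | x i = y i].
    move=> i; have hx := @proj_continuous nat (fun=> bool) i x [set x i].
    by apply: filterS (hx (discrete_set1 _)) => y /= ->.
  pose P (i : 'I_n) (y : cantor_space) := x i = y i.
  exact: (@filter_forall _ _ P _ _ h).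
apply: filterS agree => y xy; apply: xeA.
apply: lt_trans ne; apply/(theta_dist_lt _ _ _ t01) => i ni.
exact: (xy (Ordinal ni)).
Qed.

Section thermodynamic_formalism.
Context {R : realType}.
Implicit Types mu nu : probability shift_space R.

Definition shift_invariant mu : Prop :=
  forall A, measurable A -> mu (shift_map @^-1` A) = mu A.

(* A finite measurable partition is given by its labelling
   [xi : shift_space -> 'I_k]; the atoms of the join of its first n preimages
   under the iterates of [shift_map] are indexed by the n-tuples of labels. *)
Definition join_atom k (xi : shift_space -> 'I_k) n (w : n.-tuple 'I_k) :
    set shift_space :=
  [set x | forall j : 'I_n, xi (iter j shift_map x) = tnth w j].

Definition join_entropy mu k (xi : shift_space -> 'I_k) (n : nat) : R :=
  \sum_(w : n.-tuple 'I_k)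
    let p := fine (mu (join_atom xi w)) in - (p * ln p).

Definition partition_entropy mu k (xi : shift_space -> 'I_k) : R :=
  limn (fun n => join_entropy mu xi n / n%:R).

Definition ks_entropy mu : \bar R :=
  ereal_sup [set h | exists k (xi : shift_space -> 'I_k),
    (forall j, measurable (xi @^-1` [set j])) /\
    h = (partition_entropy mu xi)%:E].

Definition free_energy (g : shift_space -> R) mu : \bar R :=
  (\int[mu]_x (g x)%:E + ks_entropy mu)%E.

Definition pressure (g : shift_space -> R) : \bar R :=
  ereal_sup [set free_energy g nu | nu in [set nu | shift_invariant nu]].

Definition attains_pressure (g : shift_space -> R) mu : Prop :=
  shift_invariant mu /\ free_energy g mu = pressure g.

(* Uniqueness is as a Borel measure: the values of a probability outside the
   sigma-algebra are junk, so Leibniz equality would be too strong. *)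
Definition equilibrium_measure (g : shift_space -> R) mu : Prop :=
  attains_pressure g mu /\
  forall nu, attains_pressure g nu ->
    forall A, measurable A -> nu A = mu A.

Definition large_deviation_principle (mu : R -> probability shift_space R)
    (I : shift_space -> \bar R) : Prop :=
  [/\ forall x, (0 <= I x)%E,
      lower_semicontinuous I &
      forall w, ((beta^-1)%:E * lne (mu beta (cylinder w)))%E @[beta --> +oo]
        --> (- ereal_inf (I @` cylinder w))%E].

Definition Rplus (f U : shift_space -> R) (x : shift_space) : R :=
  - f x - U x + U (shift_map x).

Definition Rplus_sum (f U : shift_space -> R) (n : nat) (x : shift_space) : R :=
  \sum_(j < n) Rplus f U (iter j shift_map x).

Definition Rplus_lim (f U : shift_space -> R) (x : shift_space) : \bar R :=
  limn (fun n => (Rplus_sum f U n x)%:E).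

End thermodynamic_formalism.

(* Main.v *)
Require Import Defs.
From HB Require Import structures.
From mathcomp Require Import all_boot all_order all_algebra.
From mathcomp Require Import all_classical all_reals all_analysis.
From mathcomp Require Import measurable_realfun ring lra zify.

Set Implicit Arguments.
Unset Strict Implicit.
Unset Printing Implicit Defensive.
Import Order.TTheory GRing.Theory Num.Theory.
Import numFieldNormedType.Exports.

Local Open Scope classical_set_scope.
Local Open Scope ring_scope.

(** The potential [f] depends only on the symbol and the remaining length of the
    first block of a point. Let [energy s n] be the sum of [f] along a complete
    block of [n] symbols [s], and [energy_inf s] its limit.

    At fixed [beta] the equilibrium measure is a stationary alternating renewal
    process: the lengths of successive blocks are independent, and a block of
    [n] symbols [s] has probability [expR (beta * energy s n) * z ^+ n] divided by
    the sum [boltz_sum s] of these weights. Here [- ln z] is the pressure; it is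
    determined by the equation [boltz_sum false * boltz_sum true = 1], which has a
    solution by the intermediate value theorem ([exists_pressure]). The weights of
    cylinders are products of block probabilities with tail sums at both ends
    ([weight]); tail sums make them consistent and shift invariant, so they come
    from an invariant measure ([exists_renewal_measure], which is an image of the
    Lebesgue measure by [exists_cylinder_probability]). Up to a bounded factor the
    weight of the prefix of length [n] of [x] is the exponential of the Birkhoff
    sum of [beta * f] minus [n] times the pressure ([gibbs_weight_defect]), and a
    measure with this property attains the pressure ([gibbs_attains_pressure]): by
    Gibbs' inequality its cylinder weights bound the entropy of every invariant
    measure and of every finite partition ([join_entropy_le_words]). Uniqueness of
    the equilibrium measure then identifies [mu beta] on cylinders
    ([equilibrium_cylinder]).

    As [beta] tends to infinity, all quantities have exponential rates. With
    [kappa s = (energy_inf s - energy_inf (~~ s)) / 2] and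
    [rho = - (energy_inf false + energy_inf true) / 2], the two hypotheses on the
    sums of [a] and [c] say that [energy s 1 <= kappa s]: short blocks do not
    dominate [boltz_sum s]. Consequently [boltz_sum s] has rate [kappa s], the mean
    length [(1 - z)^-1] of a geometric block has rate [rho], the tails of the block
    lengths have rate [0], and their second tails have rate [rho]. A complete
    block of [n] symbols [s] thus costs [kappa s - energy s n], and the weight of a
    word has rate [- dev w], where [dev w] is [0] for words with one run and
    otherwise [rho] plus the costs of the complete blocks strictly inside [w]
    ([rate_weight]).

    On the other side [R_+] vanishes unless the point changes symbol at its first
    step; there it is the cost of the block that begins, or [rho] when this block is
    infinite. So the deviation function adds up block costs ([total]). Its infimum
    over a cylinder is [dev w], attained by repeating the last symbol forever
    ([ereal_inf_total]). As two successive blocks cost at least [- b - d > 0], it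
    is infinite at the points that are not eventually constant. *)

(** * Words, prefixes and the Borel structure of the shift space *)

Definition pref (n : nat) (x : shift_space) : seq bool := mkseq x n.

Lemma size_pref n x : size (pref n x) = n.
Proof. exact: size_mkseq. Qed.

Canonical pref_tuple n x := Tuple (introT eqP (size_pref n x)).

Lemma nth_pref n x i : (i < n)%N -> nth false (pref n x) i = x i.
Proof. by move=> ni; rewrite nth_mkseq. Qed.

Lemma prefS n x : pref n.+1 x = x 0%N :: pref n (shift_map x).
Proof.
apply: (@eq_from_nth _ false) => [|i]; rewrite size_pref; first by rewrite /= size_pref.
by move=> ni; rewrite nth_pref//; case: i ni => //= i ni; rewrite nth_pref.
Qed.

Lemma iter_shiftE i x : (iter i shift_map x) 0%N = x i.
Proof. by elim: i x => // i IH x; rewrite iterSr IH. Qed.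

Lemma concat_cons s w y : concat (s :: w) y =
  fun i => if i is j.+1 then concat w y j else s.
Proof. by apply/funext => -[|i]. Qed.

Lemma shift_concat_cons s w y : shift_map (concat (s :: w) y) = concat w y.
Proof. by []. Qed.

Lemma concat_nil y : concat [::] y = y.
Proof. by apply/funext => i; rewrite /concat /= subn0. Qed.

Lemma concat_cat v w y : concat (v ++ w) y = concat v (concat w y).
Proof. by elim: v => [|s v IH]; rewrite ?concat_nil//= !concat_cons IH. Qed.

Lemma concat_head_shift x : concat [:: x 0%N] (shift_map x) = x.
Proof. by rewrite concat_cons concat_nil; apply/funext => -[]. Qed.

Lemma pref_concat w y : pref (size w) (concat w y) = w.
Proof.
by elim: w => // s w IH; rewrite [size _]/= prefS shift_concat_cons IH.
Qed.

Lemma concat_pref n x : concat (pref n x) (iter n shift_map x) = x.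
Proof.
elim: n x => [|n IH] x; first by rewrite concat_nil.
rewrite prefS iterSr concat_cons IH.
by apply/funext => -[].
Qed.

Lemma cylinderE w : cylinder w = [set x | pref (size w) x = w].
Proof.
apply/seteqP; split => x /=; first by case=> y ->; rewrite pref_concat.
by move=> <-; exists (iter (size w) shift_map x); rewrite concat_pref.
Qed.

Lemma cylinder_cons s w x :
  cylinder (s :: w) x <-> x 0%N = s /\ cylinder w (shift_map x).
Proof.
rewrite !cylinderE /= prefS; split; first by case.
by case=> -> ->.
Qed.

Lemma cylinder_pref n x : cylinder (pref n x) x.
Proof. by rewrite cylinderE /= size_pref. Qed.

Lemma cylinder_nil : cylinder [::] = setT.
Proof. by apply/seteqP; split => // x _; exists x; rewrite concat_nil. Qed.

Lemma cylinder_preimage w :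
  shift_map @^-1` cylinder w = cylinder (false :: w) `|` cylinder (true :: w).
Proof.
apply/seteqP; split=> x /=.
  by move=> h; case E : (x 0%N); [right|left]; apply/cylinder_cons.
by case=> /cylinder_cons[].
Qed.

Lemma cylinder_preimage_disjoint w :
  cylinder (false :: w) `&` cylinder (true :: w) = set0.
Proof.
apply/seteqP; split=> x //= [] /cylinder_cons[x0 _] /cylinder_cons[].
by rewrite x0.
Qed.

Lemma pref_agree n x y :
  pref n x = pref n y <-> (forall i, (i < n)%N -> x i = y i).
Proof.
split=> [xy i ni|xy]; first by rewrite -(nth_pref x ni) xy nth_pref.
by apply/eq_in_map => i; rewrite mem_iota add0n => /xy.
Qed.

Lemma open_cylinder w : open (cylinder w : set shift_space).
Proof.
rewrite cylinderE openE => x /= xw.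
have h (i : 'I_(size w)) : nbhs (x : cantor_space) [set y | x i = y i].
  have hx := @proj_continuous nat (fun=> bool) i x [set x i].
  by apply: filterS (hx (discrete_set1 _)) => y /= ->.
pose P (i : 'I_(size w)) (y : cantor_space) := x i = y i.
apply: filterS (@filter_forall _ _ P _ _ h) => y xy /=.
by rewrite -{2}xw; apply/pref_agree => i iw; rewrite (xy (Ordinal iw)).
Qed.

Lemma cylinder_nbhs n x : nbhs x (cylinder (pref n x)).
Proof. apply: open_nbhs_nbhs; split; [exact: open_cylinder|exact: cylinder_pref]. Qed.

Lemma open_bigcup_cylinder (A : set shift_space) : open A ->
  A = \bigcup_(w in [set w | cylinder w `<=` A]) cylinder w.
Proof.
move=> oA; apply/seteqP; split => [x Ax|x [w/= wA] /wA//].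
apply: contrapT => nA.
have /choice[y yP] : forall n, exists y, pref n x = pref n y /\ ~ A y.
  move=> n; apply: contrapT => /forallNP h; apply: nA.
  exists (pref n x); last exact: cylinder_pref.
  move=> y /=; rewrite cylinderE /= size_pref => yx.
  by apply: contrapT => nAy; apply: (h y).
have yx : {ptws, (y : nat -> nat -> bool) @ \oo --> (x : nat -> bool)}.
  apply/pointwise_cvgP => i B xB.
  exists i.+1 => // n /= ni; have /pref_agree/(_ i ni) <- := (yP n).1.
  exact: nbhs_singleton.
have /yx : nbhs (x : cantor_space) A by exact: open_nbhs_nbhs.
by case=> n _ /(_ n (leqnn n)); exact: (yP n).2.
Qed.

(** The empty set is added to make the family stable under intersection. *)
Definition cylinders : set (set shift_space) := set0 |` range cylinder.

Lemma measurable_cylinder w : measurable (cylinder w : set shift_space).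
Proof. by apply: sub_sigma_algebra; exact: open_cylinder. Qed.

Lemma measurable_shiftE : @measurable _ shift_space = <<s cylinders >>.
Proof.
apply/seteqP; split; apply: smallest_sub; try exact: smallest_sigma_algebra.
- move=> A oA; rewrite (open_bigcup_cylinder oA).
  pose F (o : option (seq bool)) := if o is Some w then
    if `[< cylinder w `<=` A >] then cylinder w else set0 else set0.
  have mF o : <<s cylinders >> (F o).
    case: o => [w|] /=; last exact: sigma_algebra0.
    case: ifP => _; last exact: sigma_algebra0.
    by apply: sub_sigma_algebra; right; exists w.
  rewrite (_ : \bigcup_(w in _) _ = \bigcup_n F (unpickle n)).
    by apply: sigma_algebra_bigcup.
  apply/seteqP; split => x.
    case=> w /asboolP wA wx; exists (pickle w); first by [].
    by rewrite (pickleK w : unpickle (pickle w) = Some w) /F wA.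
  case=> n _; case: (unpickle n) => // w; rewrite /F; case: asboolP => // wA wx.
  by exists w.
- move=> A [->|[w _ <-]]; first exact: measurable0.
  exact: measurable_cylinder.
Qed.

Lemma cylinders_setI : setI_closed cylinders.
Proof.
have key v w : (size v <= size w)%N -> cylinders (cylinder v `&` cylinder w).
  move=> vw; case: (pselect (take (size v) w = v)) => [e|ne].
    right; exists w => //; apply/esym/setIidr => x.
    rewrite !cylinderE /= => xw.
    by rewrite -[RHS]e -xw /pref /mkseq -map_take take_iota (minn_idPl vw).
  left; apply/seteqP; split => x //; rewrite !cylinderE /= => -[xv xw]; apply: ne.
  by rewrite -xw /pref /mkseq -map_take take_iota (minn_idPl vw).
move=> A B [->|[v _ <-]] [->|[w _ <-]];
  rewrite ?set0I ?setI0; try by left.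
by have [/key//|/ltnW/key] := leqP (size v) (size w); rewrite setIC.
Qed.

Lemma measurable_shift_map : measurable_fun setT shift_map.
Proof.
apply: (measurability _ measurable_shiftE).
move=> _ [_ [->|[w _ <-]] <-]; rewrite setTI ?preimage_set0//.
by rewrite cylinder_preimage; apply: measurableU; exact: measurable_cylinder.
Qed.

HB.instance Definition _ :=
  isMeasurableFun.Build _ _ _ _ shift_map measurable_shift_map.

Section measure_on_cylinders.
Context {R : realType}.
Implicit Types mu nu : {measure set shift_space -> \bar R}.

Lemma eq_measure_cylinder (mu nu : {measure set shift_space -> \bar R}) :
  (mu setT < +oo)%E -> (forall w, mu (cylinder w) = nu (cylinder w)) ->
  forall A, measurable A -> mu A = nu A.
Proof.
move=> muT munu; apply: (@measure_unique _ R _ cylinders (fun=> setT)).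
- exact: measurable_shiftE.
- exact: cylinders_setI.
- by move=> _; right; exists [::] => //; exact: cylinder_nil.
- exact: bigcup_const.
- by move=> A [->|[w _ <-]]; rewrite ?measure0.
- by [].
Qed.

Lemma measurable_iter_shift n : measurable_fun setT (iter n shift_map).
Proof.
elim: n => [|n IH]; first exact: measurable_id.
exact: (measurableT_comp measurable_shift_map IH).
Qed.

Lemma measurable_pref n (Q : pred (seq bool)) :
  measurable [set x | Q (pref n x)].
Proof.
rewrite (_ : mkset _ =
    \bigcup_(w in [set w : n.-tuple bool | Q w]) cylinder w).
  by apply: fin_bigcup_measurable => // w _; exact: measurable_cylinder.
apply/seteqP; split => x /=.
  by move=> Qx; exists [tuple of pref n x] => //=; exact: cylinder_pref.
by case=> w /= Qw; rewrite cylinderE /= size_tuple => ->.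
Qed.

Lemma measurable_pref_tuple n (u : n.-tuple bool) :
  measurable (pref_tuple n @^-1` [set u]).
Proof.
rewrite (_ : _ @^-1` _ = [set x | pref n x == u]).
  exact: (measurable_pref n (pred1 (val u))).
apply/seteqP; split => x /=; first by move=> <-.
by move=> /eqP xu; apply: val_inj.
Qed.

Lemma measurable_fun_pref n (F : seq bool -> R) :
  measurable_fun setT (fun x => F (pref n x)).
Proof.
move=> _ B mB; rewrite setTI.
have := measurable_pref n (fun w => `[< B (F w) >]).
by congr (measurable _); apply/seteqP; split => x /= /asboolP.
Qed.

(** A Lipschitz function is the pointwise limit of functions of finitely many
    coordinates. *)
Lemma Lipschitz_measurable (theta : R) (f : shift_space -> R) :
  0 < theta < 1 -> Lipschitz theta f -> measurable_fun setT f.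
Proof.
move=> t01 [L fL].
pose g n x := f (concat (pref n x) (const_point false)).
apply: (@measurable_fun_cvg _ _ _ _ g).
  by move=> n; exact: (@measurable_fun_pref n
    (fun w => f (concat w (const_point false)))).
move=> x _; apply/cvgrPdist_le => e e0.
have L0 : 0 < `|L| + 1 by rewrite ltr_wpDl.
have t0t : theta ^+ n @[n --> \oo] --> 0.
  by apply: cvg_expr; case/andP: t01 => ? ?; rewrite ger0_norm ?ltW.
case/andP: (t01) => t0 t1.
have small := cvgr0_norm_lt _ t0t _ (divr_gt0 e0 L0).
case: small => N _ small; exists N => // n /small /=.
rewrite (ger0_norm (exprn_ge0 _ (ltW t0))) => ne.
apply: le_trans (fL _ _) _.
have xg : theta_dist theta x (concat (pref n x) (const_point false)) < theta ^+ n.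
  apply/theta_dist_lt => // i ni.
  by rewrite /concat size_pref ni nth_pref.
have d0 : 0 <= theta_dist theta x (concat (pref n x) (const_point false)).
  by rewrite /theta_dist; case: pselect => // h; rewrite exprn_ge0// ltW.
apply: (@le_trans _ _ ((`|L| + 1) * theta ^+ n)).
  apply: le_trans (ler_norm _) _; rewrite normrM (ger0_norm d0).
  by apply: ler_pM => //; [rewrite lerDl|exact: ltW].
by rewrite mulrC -ler_pdivlMr// ltW.
Qed.

End measure_on_cylinders.

(** * Integrals of bounded functions and of finite labellings *)

Section bounded_measurable.
Context {R : realType} {d : measure_display} {T : measurableType d}.
Implicit Types (mu : probability T R) (f g : T -> R).

Definition bounded_measurable f : Prop :=
  measurable_fun setT f /\ exists M, forall x, `|f x| <= M.

Lemma bounded_measurable_integrable mu f :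
  bounded_measurable f -> mu.-integrable setT (EFin \o f).
Proof.
case=> mf [M fM]; apply: measurable_bounded_integrable => //.
  by rewrite -ge0_fin_numE// fin_num_measure.
exists M; split; first exact: num_real.
by move=> r Mr x _ /=; exact: le_trans (fM x) (ltW Mr).
Qed.

Lemma bounded_measurable_cst (r : R) : bounded_measurable (fun=> r).
Proof. by split; [exact: measurable_cst|exists `|r|]. Qed.

Lemma bounded_measurableD f g : bounded_measurable f -> bounded_measurable g ->
  bounded_measurable (fun x => f x + g x).
Proof.
move=> [mf [M fM]] [mg [N gN]]; split; first exact: measurable_funD.
by exists (M + N) => x; rewrite (le_trans (ler_normD _ _))// lerD.
Qed.

Lemma bounded_measurableZ (r : R) f : bounded_measurable f ->
  bounded_measurable (fun x => r * f x).
Proof.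
move=> [mf [M fM]]; split; first exact: measurable_funM.
by exists (`|r| * M) => x; rewrite normrM ler_wpM2l.
Qed.

Lemma bounded_measurable_sum (I : Type) (s : seq I) (F : I -> T -> R) :
  (forall i, bounded_measurable (F i)) ->
  bounded_measurable (fun x => \sum_(i <- s) F i x).
Proof.
move=> bF; elim: s => [|i s IH].
  by under eq_fun do rewrite big_nil; exact: bounded_measurable_cst.
under eq_fun do rewrite big_cons.
exact: bounded_measurableD.
Qed.

Lemma bounded_measurable_indic (A : set T) : measurable A ->
  bounded_measurable (\1_A : T -> R).
Proof.
move=> mA; split; first exact: measurable_indic.
by exists 1 => x; rewrite indicE ger0_norm// lern1; case: (x \in A).
Qed.

Lemma Rint_sum mu (I : Type) (s : seq I) (F : I -> T -> R) :
  (forall i, bounded_measurable (F i)) ->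
  \int[mu]_x (\sum_(i <- s) F i x) = \sum_(i <- s) \int[mu]_x F i x.
Proof.
move=> bF; elim: s => [|i s IH].
  under eq_Rintegral do rewrite big_nil.
  by rewrite Rintegral_cst// mul0r big_nil.
under eq_Rintegral do rewrite big_cons.
rewrite RintegralD// ?IH ?big_cons//; apply: bounded_measurable_integrable => //.
exact: bounded_measurable_sum.
Qed.

Lemma RintD mu f g : bounded_measurable f -> bounded_measurable g ->
  \int[mu]_x (f x + g x) = \int[mu]_x f x + \int[mu]_x g x.
Proof.
by move=> bf bg; rewrite RintegralD//; exact: bounded_measurable_integrable.
Qed.

Lemma RintZ mu (r : R) f : bounded_measurable f ->
  \int[mu]_x (r * f x) = r * \int[mu]_x f x.
Proof.
by move=> bf; rewrite RintegralZl//; exact: bounded_measurable_integrable.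
Qed.

Lemma Rint_cst mu (r : R) : \int[mu]_x r = r.
Proof.
have mu1 : mu setT = 1%E by exact: probability_setT.
by rewrite Rintegral_cst// [X in fine X]mu1 mulr1.
Qed.

Lemma le_Rint mu f g : bounded_measurable f -> bounded_measurable g ->
  (forall x, f x <= g x) -> \int[mu]_x f x <= \int[mu]_x g x.
Proof.
by move=> bf bg fg; apply: le_Rintegral => //; exact: bounded_measurable_integrable.
Qed.

Lemma Rint_indic mu (A : set T) : measurable A ->
  \int[mu]_x (\1_A x : R) = fine (mu A).
Proof. by move=> mA; rewrite /Rintegral integral_indic// setIT. Qed.

Variables (J : finType) (t : T -> J).
Hypothesis mt : forall v, measurable (t @^-1` [set v]).

Lemma labelling_sum (F : J -> R) x :
  F (t x) = \sum_v F v * \1_(t @^-1` [set v]) x.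
Proof.
rewrite (bigD1 (t x))//= big1 => [|v vt].
  by rewrite addr0 indicE mem_set// mulr1.
by rewrite indicE memNset ?mulr0// => /= e; rewrite e eqxx in vt.
Qed.

Lemma bounded_measurable_labelling (F : J -> R) :
  bounded_measurable (fun x => F (t x)).
Proof.
under eq_fun do rewrite labelling_sum.
apply: bounded_measurable_sum => v.
exact/bounded_measurableZ/bounded_measurable_indic.
Qed.

Lemma Rint_labelling mu (F : J -> R) :
  \int[mu]_x F (t x) = \sum_v F v * fine (mu (t @^-1` [set v])).
Proof.
under eq_Rintegral do rewrite labelling_sum.
rewrite Rint_sum; last first.
  by move=> v; exact/bounded_measurableZ/bounded_measurable_indic.
by apply: eq_bigr => v _; rewrite RintZ ?Rint_indic//; exact: bounded_measurable_indic.
Qed.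

(** Gibbs' inequality: the entropy of a labelling is at most its cross entropy
    with any sub-probability vector, since [ln y <= y - 1]. *)
Lemma entropy_le_cross_entropy mu (q : J -> R) :
  (forall v, 0 < q v) -> \sum_v q v <= 1 ->
  \sum_v (let p := fine (mu (t @^-1` [set v])) in - (p * ln p))
    <= - \int[mu]_x ln (q (t x)).
Proof.
move=> q0 q1; pose p v := fine (mu (t @^-1` [set v])).
have p0 v : 0 <= p v by exact: fine_ge0.
have sp : \sum_v p v = 1.
  have := Rint_labelling mu (fun=> 1); rewrite Rint_cst => ->.
  by apply: eq_bigr => v _; rewrite mul1r.
rewrite (Rint_labelling mu (fun v => ln (q v))) -sumrN -subr_ge0 -sumrB /=.
have q1p : 0 <= \sum_v (p v - q v) by rewrite sumrB sp subr_ge0.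
apply: le_trans q1p _; apply: ler_sum => v _; rewrite -/(p v).
have [->|pv] := eqVneq (p v) 0; first by rewrite !(mulr0,mul0r) oppr0 subrr sub0r oppr_le0 ltW.
have {}pv : 0 < p v by rewrite lt_neqAle eq_sym pv p0.
have : ln (q v / p v) <= q v / p v - 1.
  have qp : 0 < q v / p v by rewrite divr_gt0.
  rewrite -[X in ln X](addrNK 1) addrC le_ln1Dx//; lra.
rewrite ln_div ?posrE// => /(ler_wpM2l (ltW pv)).
rewrite !mulrBr mulr1 mulrCA divff ?gt_eqF// mulr1 => h.
rewrite opprK; lra.
Qed.

End bounded_measurable.

(** * Approximation of measurable labellings by words *)

Lemma take_pref m n x : (m <= n)%N -> take m (pref n x) = pref m x.
Proof. by move=> mn; rewrite /pref /mkseq -map_take take_iota (minn_idPl mn). Qed.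

Section approximation.
Context {R : realType} (mu : probability shift_space R).

Lemma fineE_prob (A : set shift_space) : measurable A -> mu A = (fine (mu A))%:E.
Proof. by move=> mA; rewrite fineK// fin_num_measure. Qed.

Lemma fine_prob_le (A B : set shift_space) : measurable A -> measurable B ->
  A `<=` B -> fine (mu A) <= fine (mu B).
Proof.
move=> mA mB AB; rewrite fine_le ?fin_num_measure//.
by rewrite le_measure ?inE.
Qed.

Lemma fine_probU (A B : set shift_space) : measurable A -> measurable B ->
  fine (mu (A `|` B)) <= fine (mu A) + fine (mu B).
Proof.
move=> mA mB; rewrite -fineD ?fin_num_measure// fine_le ?fin_numD ?fin_num_measure//.
  exact: measurableU.
exact: measureU2.
Qed.

(** The points at which membership in [A] is not what the word of length [m]
    predicts: the symmetric difference of [A] and a union of cylinders. *)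
Definition mismatch (A : set shift_space) m (Q : pred (seq bool)) :=
  [set x | `[< A x >] != Q (pref m x)].

Lemma measurable_mismatch A m Q : measurable A -> measurable (mismatch A m Q).
Proof.
move=> mA; have mQ := measurable_pref m Q.
rewrite (_ : mismatch A m Q = (A `\` [set x | Q (pref m x)]) `|`
                              ([set x | Q (pref m x)] `\` A)).
  by apply: measurableU; exact: measurableD.
apply/seteqP; split => x; rewrite /mismatch /=.
  by case: asboolP => Ax; case: (Q _) => // _; [left|right].
by case: asboolP => Ax; case: (Q _) => // -[[]|[]].
Qed.

Definition word_approximable (A : set shift_space) := measurable A /\
  forall e : R, 0 < e -> exists m Q, fine (mu (mismatch A m Q)) < e.

Lemma word_approximableU A B :
  word_approximable A -> word_approximable B -> word_approximable (A `|` B).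
Proof.
move=> [mA aA] [mB aB]; split; first exact: measurableU.
move=> e e0; have e20 : 0 < e / 2 by rewrite divr_gt0.
have [m [Q AQ]] := aA _ e20; have [n [S BS]] := aB _ e20.
exists (maxn m n), (fun w => Q (take m w) || S (take n w)).
rewrite [e]splitr; apply: le_lt_trans (ltrD AQ BS).
apply: (le_trans _ (fine_probU (measurable_mismatch _ _ mA)
  (measurable_mismatch _ _ mB))).
apply: fine_prob_le; first by apply: measurable_mismatch; exact: measurableU.
  by apply: measurableU; exact: measurable_mismatch.
move=> x; rewrite /mismatch /= !take_pref ?leq_maxl ?leq_maxr//.
rewrite asbool_or; case: (`[< A x >]); case: (`[< B x >]);
  case: (Q _); case: (S _); rewrite /=; by [left|right].
Qed.

(** Regularity of Borel measures for cylinders. The approximable sets form a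
    sigma-algebra: an infinite union is within any [e] of a finite one by
    continuity of the measure from below. *)
Lemma measurable_word_approximable A : measurable A -> word_approximable A.
Proof.
rewrite measurable_shiftE; apply: smallest_sub; last first.
  have base (C : set shift_space) m Q : measurable C ->
      mismatch C m Q = set0 -> word_approximable C.
    by move=> mC CQ; split=> // e e0; exists m, Q; rewrite CQ measure0.
  move=> _ [->|[w _ <-]].
    apply: (base _ 0%N pred0); first exact: measurable0.
    by apply/seteqP; split=> x //; rewrite /mismatch /= asboolF.
  apply: (base _ (size w) (pred1 w)); first exact: measurable_cylinder.
  apply/seteqP; split=> x //; rewrite /mismatch /= cylinderE.
  by case: asboolP => /= [->|/eqP/negbTE ->]; rewrite ?eqxx.
split.
- split; first exact: measurable0.
  move=> e e0; exists 0%N, pred0.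
  rewrite (_ : mismatch _ _ _ = set0) ?measure0//.
  by apply/seteqP; split=> x //; rewrite /mismatch /= asboolF.
- move=> B [mB aB]; rewrite setTD; split; first exact: measurableC.
  move=> e /aB[m [Q BQ]]; exists m, (predC Q).
  rewrite (_ : mismatch _ _ _ = mismatch B m Q)//.
  apply/seteqP; split=> x; rewrite /mismatch /= asbool_neg;
    by case: (`[< B x >]); case: (Q _).
- move=> B aB; pose F n := \big[setU/set0]_(i < n.+1) B i.
  have mB i : measurable (B i) by have [] := aB i.
  have aF n : word_approximable (F n).
    rewrite /F; elim/big_ind: _ => //; last by move=> *; exact: word_approximableU.
    split; first exact: measurable0.
    move=> e e0; exists 0%N, pred0.
    rewrite (_ : mismatch _ _ _ = set0) ?measure0//.
    by apply/seteqP; split=> x //; rewrite /mismatch /= asboolF.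
  have mF n : measurable (F n) by have [] := aF n.
  have mU : measurable (\bigcup_k B k) by exact: bigcup_measurable.
  have FU : \bigcup_n F n = \bigcup_k B k by rewrite /F bigcup_bigsetU_bigcup.
  split=> // e e0; have e20 : 0 < e / 2 by rewrite divr_gt0.
  have cF : fine (mu (F n)) @[n --> \oo] --> fine (mu (\bigcup_k B k)).
    apply: fine_cvg; rewrite -fineE_prob// -FU.
    apply: nondecreasing_cvg_mu => //; first by rewrite FU.
    by move=> m n mn; apply/subsetPset; exact: subset_bigsetU.
  have [n _] := cvgr_dist_lt _ _ cF _ e20.
  move=> /(_ n (leqnn n)) /= nF.
  have [m [Q FQ]] := (aF n).2 _ e20.
  exists m, Q; rewrite [e]splitr.
  pose D := (\bigcup_k B k) `\` F n.
  have mD : measurable D by exact: measurableD.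
  have FsU : F n `<=` \bigcup_k B k by rewrite -FU; exact: bigcup_sup.
  have De : fine (mu D) < e / 2.
    apply: le_lt_trans nF; rewrite /D measureD ?ltey_eq ?fin_num_measure//.
    rewrite setIidr// fineB ?fin_num_measure//; exact: ler_norm.
  apply: le_lt_trans (ltrD De FQ).
  apply: (le_trans _ (fine_probU mD (measurable_mismatch _ _ (mF n)))).
  apply: fine_prob_le; first exact: measurable_mismatch.
    by apply: measurableU => //; exact: measurable_mismatch.
  move=> x; rewrite /mismatch /D /=; case: (asboolP (F n x)) => Fx.
    by rewrite asboolT; [move=> ?; right|exact: FsU].
  by case: asboolP => Ux; case: (Q _) => //= _; [left|right].
Qed.

(** Every label is approximated separately; the word predicts the first label
    whose approximation contains it, which is wrong only on the union of the
    [k] mismatches. *)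
Lemma labelling_word_approximation k (xi : shift_space -> 'I_k) (e : R) :
  (forall j, measurable (xi @^-1` [set j])) -> 0 < e ->
  exists m (l : seq bool -> 'I_k),
    measurable [set x | xi x != l (pref m x)] /\
    fine (mu [set x | xi x != l (pref m x)]) < e.
Proof.
move=> mxi e0.
have bigE (E : 'I_k -> set shift_space) :
    \big[setU/set0]_(j < k) E j = \bigcup_j E j.
  rewrite -(bigcup_pred predT); congr (bigcup _ _).
  by apply/seteqP; split.
have k0 : (0 < k)%N := leq_ltn_trans (leq0n _) (ltn_ord (xi (const_point false))).
have ek0 : 0 < e / k%:R by rewrite divr_gt0// ltr0n.
have /choice[mQ mQP] : forall j : 'I_k, exists p : nat * pred (seq bool),
    fine (mu (mismatch (xi @^-1` [set j]) p.1 p.2)) < e / k%:R.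
  move=> j; have [_ /(_ _ ek0)[m [Q ?]]] := measurable_word_approximable (mxi j).
  by exists (m, Q).
pose m := \max_j (mQ j).1.
pose l w := odflt (xi (const_point false)) [pick j | (mQ j).2 (take (mQ j).1 w)].
pose E j := mismatch (xi @^-1` [set j]) (mQ j).1 (mQ j).2.
have mE j : measurable (E j) by exact: measurable_mismatch.
have mN : measurable [set x | xi x != l (pref m x)].
  rewrite (_ : mkset _ = \big[setU/set0]_(j < k)
      (xi @^-1` [set j] `&` [set x | l (pref m x) != j])).
    apply: bigsetU_measurable => j _; apply: measurableI => //.
    exact: (measurable_pref m (fun w => l w != j)).
  rewrite bigE.
  apply/seteqP; split=> x /=.
    by move=> xl; exists (xi x) => //=; split => //; rewrite eq_sym.
  by case=> j _ /= [<-]; rewrite eq_sym.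
exists m, l; split=> //.
have sub : [set x | xi x != l (pref m x)] `<=` \big[setU/set0]_(j < k) E j.
  rewrite bigE => x /= xl; apply: contrapT => nE.
  have hj j : (mQ j).2 (take (mQ j).1 (pref m x)) = (j == xi x).
    rewrite take_pref; last exact: leq_bigmax.
    have /negP/negPn/eqP <- : ~ E j x by move=> h; apply: nE; exists j.
    by rewrite eq_sym; apply/asboolP/eqP.
  move: xl; rewrite /l; case: pickP => [j|/(_ (xi x))]; rewrite hj.
    by move/eqP => ->; rewrite eqxx.
  by rewrite eqxx.
have [_ EE] : measurable (\big[setU/set0]_(j < k) E j) /\
    fine (mu (\big[setU/set0]_(j < k) E j)) <= \sum_(j < k) fine (mu (E j)).
  pose K A s := measurable A /\ fine (mu A) <= s.
  apply: (big_ind2 K) => [|A r B s [mA Ar] [mB Bs]|j _]; first by rewrite /K measure0.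
  - by split; [exact: measurableU|exact: le_trans (fine_probU _ _) (lerD Ar Bs)].
  - by split.
apply: le_lt_trans (fine_prob_le mN _ sub) _.
  exact: bigsetU_measurable.
apply: le_lt_trans EE _.
apply: (@lt_le_trans _ _ (\sum_(j < k) e / k%:R)).
  apply: ltr_sum => [|j _]; last exact: mQP.
  by apply/hasP; exists (Ordinal k0); rewrite ?mem_index_enum.
by rewrite sumr_const card_ord -(mulr_natr (e / k%:R)) divfK// pnatr_eq0 -lt0n.
Qed.

End approximation.

(** * Gibbs measures are equilibrium measures *)

Definition birkhoff_sum {R : realType} (g : shift_space -> R) n x : R :=
  \sum_(j < n) g (iter j shift_map x).

Lemma birkhoff_sumS {R : realType} (g : shift_space -> R) n x :
  birkhoff_sum g n.+1 x = g x + birkhoff_sum g n (shift_map x).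
Proof.
rewrite /birkhoff_sum big_ord_recl; congr (_ + _).
by apply: eq_bigr => j _; rewrite -iterSr.
Qed.

Lemma pref_iter_shift n m j x : (j + m <= n)%N ->
  take m (drop j (pref n x)) = pref m (iter j shift_map x).
Proof.
elim: j n x => [|j IH] [|n] x // h; rewrite ?drop0 ?take_pref//.
by rewrite prefS iterSr [drop _ _]/= IH.
Qed.

Section entropy.
Context {R : realType}.
Implicit Types (mu nu : probability shift_space R) (g : shift_space -> R).

Lemma bounded_measurable_iter g j : bounded_measurable g ->
  bounded_measurable (fun x => g (iter j shift_map x)).
Proof.
move=> [mg [M gM]]; split; last by exists M.
exact: (measurableT_comp mg (measurable_iter_shift j)).
Qed.

Lemma Rint_iter_shift mu g j : shift_invariant mu -> bounded_measurable g ->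
  \int[mu]_x g (iter j shift_map x) = \int[mu]_x g x.
Proof.
move=> inv; elim: j => //= j IH bg.
rewrite -[RHS]IH//; have bh := bounded_measurable_iter j bg.
under eq_Rintegral do rewrite -iterS iterSr.
rewrite /Rintegral; congr fine.
have mh : measurable_fun setT (EFin \o (fun x => g (iter j shift_map x))).
  by apply/measurable_EFinP; case: bh.
have ih : mu.-integrable setT ((EFin \o (fun x => g (iter j shift_map x))) \o shift_map).
  have := bounded_measurable_integrable mu (bounded_measurable_iter j.+1 bg).
  by congr (_.-integrable _ _); apply/funext => x /=; rewrite -iterSr.
apply: etrans (esym (integral_distribution mh ih)) _.
by apply: eq_measure_integral => A mA _; exact: inv.
Qed.

Lemma Rint_birkhoff_sum mu g n : shift_invariant mu -> bounded_measurable g ->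
  \int[mu]_x birkhoff_sum g n x = n%:R * \int[mu]_x g x.
Proof.
move=> inv bg; rewrite Rint_sum; last first.
  by move=> j; exact: bounded_measurable_iter.
under eq_bigr do rewrite Rint_iter_shift//.
by rewrite sumr_const card_ord mulr_natl.
Qed.

Lemma bounded_measurable_birkhoff_sum g n : bounded_measurable g ->
  bounded_measurable (birkhoff_sum g n).
Proof.
by move=> bg; apply: bounded_measurable_sum => j; exact: bounded_measurable_iter.
Qed.

Section partition.
Variables (k : nat) (xi : shift_space -> 'I_k).
Hypothesis mxi : forall j, measurable (xi @^-1` [set j]).

Definition name n (x : shift_space) : n.-tuple 'I_k :=
  [tuple xi (iter j shift_map x) | j < n].

Lemma join_atomE n (w : n.-tuple 'I_k) : join_atom xi w = @name n @^-1` [set w].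
Proof.
apply/seteqP; split=> x /=.
  by move=> xw; apply: eq_from_tnth => j; rewrite tnth_mktuple xw.
by move=> <- j; rewrite tnth_mktuple.
Qed.

Lemma measurable_name n (w : n.-tuple 'I_k) : measurable (@name n @^-1` [set w]).
Proof.
rewrite -join_atomE (_ : join_atom _ _ = \bigcap_(j : 'I_n)
    ((fun x => iter j shift_map x) @^-1` (xi @^-1` [set tnth w j]))).
  apply: fin_bigcap_measurable => // j _.
  by rewrite -[X in measurable X]setTI; exact: measurable_iter_shift.
by apply/seteqP; split=> x /= xw j; [move=> _|]; apply: xw.
Qed.

Lemma join_entropy_labelling mu n :
  join_entropy mu xi n = - \int[mu]_x ln (fine (mu (join_atom xi (name n x)))).
Proof.
rewrite (Rint_labelling (@measurable_name n) mu
  (fun w => ln (fine (mu (join_atom xi w))))).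
rewrite -sumrN; apply: eq_bigr => w _ /=.
by rewrite -join_atomE mulrC.
Qed.

Lemma ln_prod (I : Type) (s : seq I) (F : I -> R) : (forall i, 0 < F i) ->
  ln (\prod_(i <- s) F i) = \sum_(i <- s) ln (F i).
Proof.
move=> F0; elim: s => [|i s IH]; first by rewrite !big_nil ln1.
by rewrite !big_cons lnM ?posrE ?prodr_gt0// IH.
Qed.

(** The entropy of [n] steps of an arbitrary partition against a probability
    [N] on words: the name of a point is coded by guessing each of its letters
    from a window of length [m] of the point, at the price of a penalty
    [ln (k / e)] for each wrong guess. *)
Lemma join_entropy_le_words mu (N : seq bool -> R) (l : seq bool -> 'I_k) (e : R) n m :
  shift_invariant mu ->
  (forall w, 0 < N w) -> \sum_(u : (n + m).-tuple bool) N u <= 1 ->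
  0 < e < 1 ->
  measurable [set x | xi x != l (pref m x)] ->
  join_entropy mu xi n <=
    - (\int[mu]_x ln (N (pref (n + m) x))) +
    n%:R * (- ln (1 - e) +
            ln (k%:R / e) * fine (mu [set x | xi x != l (pref m x)])).
Proof.
move=> inv N0 N1 /andP[e0 e1] mD.
have k0 : (0 < k)%N := leq_ltn_trans (leq0n _) (ltn_ord (xi (const_point false))).
have ke0 : 0 < k%:R / e by rewrite divr_gt0// ltr0n.
(* [Q i j] is the weight given to the letter [i] when the guess is [j]. *)
pose Q (i j : 'I_k) : R := if i == j then 1 - e else (k%:R / e)^-1.
have Q0 i j : 0 < Q i j by rewrite /Q; case: ifP => _; [lra|rewrite invr_gt0].
have Q1 j : \sum_i Q i j <= 1.
  rewrite (bigD1 j)//= {1}/Q eqxx (eq_bigr (fun=> (k%:R / e)^-1)); last first.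
    by move=> i /negbTE ij; rewrite /Q ij.
  apply: (@le_trans _ _ (1 - e + \sum_(i < k) (k%:R / e)^-1)).
    by rewrite lerD2l [leRHS](bigD1 j)//= lerDr invr_ge0 ltW.
  rewrite sumr_const card_ord -(mulr_natl (k%:R / e)^-1) invf_div mulrCA divff ?pnatr_eq0 -?lt0n//.
  lra.
pose W (w : n.-tuple 'I_k) (u : seq bool) : R :=
  \prod_(j < n) Q (tnth w j) (l (take m (drop j u))).
have W0 w u : 0 < W w u by rewrite prodr_gt0.
(* The name is first coded together with the word [u]; its own code [q] is the
   marginal, which is not smaller than any of its terms. *)
pose q w := \sum_(u : (n + m).-tuple bool) N u * W w u.
have u0 : (n + m).-tuple bool by exact: [tuple of nseq (n + m) false].
have qge w (u : (n + m).-tuple bool) : N u * W w u <= q w.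
  rewrite /q (bigD1 u)//= lerDl; apply: sumr_ge0 => v _.
  by rewrite ltW// mulr_gt0.
have q0 w : 0 < q w by apply: lt_le_trans (qge w u0); rewrite mulr_gt0.
have W1 u : \sum_w W w u <= 1.
  rewrite /W (reindex (fun h : {ffun 'I_n -> 'I_k} => [tuple h j | j < n])) /=; last first.
    exists (fun w => [ffun j => tnth w j]) => [h _|w _].
      by apply/ffunP => j; rewrite ffunE tnth_mktuple.
    by apply: eq_from_tnth => j; rewrite tnth_mktuple ffunE.
  under eq_bigr do under eq_bigr do rewrite tnth_mktuple.
  rewrite -(bigA_distr_bigA (fun (j : 'I_n) i => Q i (l (take m (drop j u))))).
  by rewrite prodr_ile1// => j _; rewrite Q1 sumr_ge0// => i _; exact: ltW.
have q1 : \sum_w q w <= 1.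
  rewrite exchange_big /=; apply: le_trans N1; apply: ler_sum => u _.
  by rewrite -mulr_sumr ler_piMr// ltW.
have := entropy_le_cross_entropy (@measurable_name n) mu q0 q1.
have -> : \sum_v (let p := fine (mu (@name n @^-1` [set v])) in - (p * ln p)) =
    join_entropy mu xi n.
  by apply: eq_bigr => w _; rewrite join_atomE.
move=> /le_trans; apply.
pose D := [set x | xi x != l (pref m x)].
have bD : bounded_measurable (\1_D : _ -> R) by exact: bounded_measurable_indic.
pose pen x := - ln (1 - e) + ln (k%:R / e) * \1_D x.
have bpen : bounded_measurable pen.
  apply: bounded_measurableD; first exact: bounded_measurable_cst.
  exact: bounded_measurableZ.
have bN : bounded_measurable (fun x => ln (N (pref (n + m) x))).
  exact: (bounded_measurable_labelling (@measurable_pref_tuple (n + m)) (fun u => ln (N u))).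
rewrite lerNl opprD opprK.
have -> : n%:R * (- ln (1 - e) + ln (k%:R / e) * fine (mu D)) =
    \int[mu]_x birkhoff_sum pen n x.
  rewrite Rint_birkhoff_sum// RintD ?Rint_cst ?RintZ ?Rint_indic//.
    exact: bounded_measurable_cst.
  exact: bounded_measurableZ.
have bS := bounded_measurable_birkhoff_sum n bpen.
have Ng (h : _ -> R) : bounded_measurable h -> \int[mu]_x (- h x) = - \int[mu]_x h x.
  by move=> bh; under eq_Rintegral do rewrite -mulN1r; rewrite RintZ ?mulN1r.
rewrite -Ng// -RintD//; last first.
  by under eq_fun do rewrite -mulN1r; exact: bounded_measurableZ.
apply: le_Rint.
- apply: bounded_measurableD => //.
  by under eq_fun do rewrite -mulN1r; exact: bounded_measurableZ.
- exact: (bounded_measurable_labelling (@measurable_name n) (fun w => ln (q w))).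
move=> x; have /= h := qge (name n x) (pref_tuple (n + m) x).
apply: le_trans (_ : _ <= ln (N (pref (n + m) x) * W (name n x) (pref (n + m) x))) _; last first.
  by rewrite ler_ln// posrE// mulr_gt0.
rewrite lnM ?posrE// lerD2l /W ln_prod// -sumrN; apply: ler_sum => j _.
rewrite tnth_mktuple pref_iter_shift; last by rewrite leq_add2r ltnW.
rewrite /pen /Q indicE; set y := iter j shift_map x.
case: eqP => [xl|/eqP xl].
  by rewrite memNset ?mulr0 ?addr0 ?opprK//= /D /= xl eqxx.
rewrite mem_set// mulr1 opprD opprK lnV ?posrE//.
by rewrite gerDr ln_le0//; lra.
Qed.

End partition.
End entropy.

Lemma cvg_invn {R : realType} : (n%:R^-1 : R) @[n --> \oo] --> 0.
Proof. by rewrite -(cvg_shiftS (fun n => n%:R^-1 : R)); exact: cvg_harmonic. Qed.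

Section gibbs.
Context {R : realType}.
Implicit Types (mu nu : probability shift_space R).

Definition first_letter (x : shift_space) : 'I_2 := if x 0%N then 1%R else 0%R.

Lemma measurable_first_letter j : measurable (first_letter @^-1` [set j]).
Proof.
rewrite (_ : _ @^-1` _ = [set x | (if nth false (pref 1 x) 0 then 1%R else 0%R) == j]).
  exact: (measurable_pref 1 (fun w => (if nth false w 0 then 1%R else 0%R) == j)).
by apply/seteqP; split=> x /=; rewrite /first_letter => /eqP.
Qed.

Lemma join_atom_first_letter n x :
  join_atom first_letter (name first_letter n x) = cylinder (pref n x).
Proof.
rewrite join_atomE cylinderE size_pref; apply/seteqP; split=> y /=.
  move=> yx; apply/pref_agree => i ni.
  have := congr1 (fun w => tnth w (Ordinal ni)) yx.
  by rewrite !tnth_mktuple /= /first_letter !iter_shiftE; case: (x i); case: (y i).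
move=> /pref_agree yx; apply: eq_from_tnth => i.
by rewrite !tnth_mktuple /first_letter !iter_shiftE yx.
Qed.

Variables (g : shift_space -> R) (nu : probability shift_space R) (P C : R).
Hypothesis bg : bounded_measurable g.
Hypothesis g_le0 : forall x, g x <= 0.
Hypothesis P_ge0 : 0 <= P.
Hypothesis nu_inv : shift_invariant nu.
Hypothesis nu_gt0 : forall w, 0 < fine (nu (cylinder w)).
Hypothesis nu_gibbs : forall n x,
  `|ln (fine (nu (cylinder (pref n x)))) - (birkhoff_sum g n x - n%:R * P)| <= C.

Let N w := fine (nu (cylinder w)).

Lemma sum_cylinders n : \sum_(u : n.-tuple bool) N u = 1.
Proof.
have := Rint_labelling (@measurable_pref_tuple n) nu (fun=> 1); rewrite Rint_cst => ->.
apply: eq_bigr => u _; rewrite mul1r /N; congr (fine (nu _)).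
rewrite cylinderE size_tuple; apply/seteqP; split => x /=; last by move=> <-.
by move=> xu; apply: val_inj.
Qed.

Lemma bounded_measurable_ln_cylinder n :
  bounded_measurable (fun x => ln (N (pref n x))).
Proof.
exact: (bounded_measurable_labelling (@measurable_pref_tuple n) (fun u => ln (N u))).
Qed.

(** Up to a constant, coding the words of length [n] of any invariant measure by
    the weights of the Gibbs measure costs [n] times [P] minus the integral of [g]. *)
Lemma cross_entropy_gibbs mu n : shift_invariant mu ->
  `|- (\int[mu]_x ln (N (pref n x))) - n%:R * (P - \int[mu]_x g x)| <= C.
Proof.
move=> inv; have bS := bounded_measurable_birkhoff_sum n bg.
have bN := bounded_measurable_ln_cylinder n.
have S_int : \int[mu]_x (birkhoff_sum g n x + (- (n%:R * P))) =
    n%:R * \int[mu]_x g x - n%:R * P.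
  by rewrite RintD ?Rint_cst ?Rint_birkhoff_sum//; exact: bounded_measurable_cst.
have bS' r : bounded_measurable (fun x => birkhoff_sum g n x + r).
  by apply: bounded_measurableD => //; exact: bounded_measurable_cst.
have up : \int[mu]_x ln (N (pref n x)) <= n%:R * \int[mu]_x g x - n%:R * P + C.
  rewrite -S_int -[X in _ <= _ + X](Rint_cst mu) -RintD//; last first.
    exact: bounded_measurable_cst.
  apply: le_Rint => //; first by apply: bounded_measurableD => //; exact: bounded_measurable_cst.
  by move=> x; have := nu_gibbs n x; rewrite ler_norml => /andP[_]; rewrite lerBlDl.
have lo : n%:R * \int[mu]_x g x - n%:R * P - C <= \int[mu]_x ln (N (pref n x)).
  rewrite -S_int -[X in _ + X <= _](Rint_cst mu) -RintD//; last first.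
    exact: bounded_measurable_cst.
  apply: le_Rint => //; first by apply: bounded_measurableD => //; exact: bounded_measurable_cst.
  move=> x; have := nu_gibbs n x; rewrite ler_norml => /andP[+ _]; rewrite lerBrDl.
  by rewrite addrC.
rewrite ler_norml; apply/andP; split; lra.
Qed.

Lemma integral_le_pressure mu : 0 <= P - \int[mu]_x g x.
Proof.
rewrite subr_ge0 (le_trans _ P_ge0)// -(Rint_cst mu 0).
by apply: le_Rint => //; exact: bounded_measurable_cst.
Qed.

(** When the averages of the join entropies diverge, their [limn] is the default
    value [0], which is below [P - \int g] as [g <= 0 <= P]. *)
Lemma partition_entropy_le mu k (xi : shift_space -> 'I_k) :
  shift_invariant mu -> (forall j, measurable (xi @^-1` [set j])) ->
  partition_entropy mu xi <= P - \int[mu]_x g x.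
Proof.
move=> inv mxi; set h := P - _; rewrite /partition_entropy.
have [cv|/dvgP ->] := pselect (cvgn (fun n => join_entropy mu xi n / n%:R));
  last exact: integral_le_pressure.
apply/ler_addgt0Pl => eta eta0.
(* [e] makes correct guesses cheap; the frequency of wrong ones is then chosen
   small compared with their penalty [ln (k / e)]. *)
have [e [e0 e1 eeta]] : exists e, [/\ 0 < e, e < 1 & - ln (1 - e) <= eta / 2].
  exists (1 - expR (- (eta / 2))).
  have lt1 : expR (- (eta / 2)) < 1 by rewrite expR_lt1 oppr_lt0 divr_gt0.
  split; [by rewrite subr_gt0|by rewrite ltrBlDr ltrDl expR_gt0|].
  by rewrite subKr expRK opprK.
have k0 : (0 < k)%N := leq_ltn_trans (leq0n _) (ltn_ord (xi (const_point false))).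
have K0 : 0 < `|ln (k%:R / e)| + 1 by rewrite ltr_wpDl.
have eK0 : 0 < eta / 2 / (`|ln (k%:R / e)| + 1) by rewrite !divr_gt0.
have [m [l [mD De]]] := labelling_word_approximation mu mxi eK0.
set D := [set x | _] in mD De.
have pen : - ln (1 - e) + ln (k%:R / e) * fine (mu D) <= eta.
  rewrite [leRHS]splitr lerD// (le_trans (ler_norm _))// normrM.
  rewrite (ger0_norm (fine_ge0 (measure_ge0 _ _))).
  apply: le_trans (_ : _ <= (`|ln (k%:R / e)| + 1) * fine (mu D)) _.
    by rewrite ler_wpM2r ?fine_ge0// lerDl.
  by rewrite mulrC -ler_pdivlMr// ltW.
have bound n : (0 < n)%N ->
    join_entropy mu xi n / n%:R <= h + eta + (m%:R * h + C) / n%:R.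
  move=> n0; rewrite ler_pdivrMr ?ltr0n//.
  have -> : (h + eta + (m%:R * h + C) / n%:R) * n%:R =
      (n + m)%:R * h + C + n%:R * eta.
    by rewrite natrD; field; rewrite pnatr_eq0 -lt0n.
  have e01 : 0 < e < 1 by rewrite e0.
  have N1 : \sum_(u : (n + m).-tuple bool) N u <= 1 by rewrite sum_cylinders.
  apply: le_trans (join_entropy_le_words mxi inv nu_gt0 N1 e01 mD) _.
  rewrite lerD ?ler_wpM2l//.
  have := cross_entropy_gibbs (n + m) inv.
  by rewrite ler_norml => /andP[_]; rewrite lerBlDl.
rewrite [eta + h]addrC.
have cvb : (fun n => h + eta + (m%:R * h + C) / n%:R) @ \oo --> h + eta.
  rewrite -[X in _ --> X]addr0; apply: cvgD; first exact: cvg_cst.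
  rewrite -(mulr0 (m%:R * h + C)); apply: cvgMl_tmp; exact: cvg_invn.
rewrite -(cvg_lim _ cvb)//; apply: ler_lim => //; first by apply/cvg_ex; exists (h + eta).
by exists 1%N => // n /= n1; exact: bound.
Qed.

Lemma free_energyE mu :
  free_energy g mu = ((\int[mu]_x g x)%:E + ks_entropy mu)%E.
Proof.
rewrite /free_energy /Rintegral fineK//.
exact: (integrable_fin_num _ (bounded_measurable_integrable mu bg)).
Qed.

Lemma free_energy_le mu : shift_invariant mu -> (free_energy g mu <= P%:E)%E.
Proof.
move=> inv; rewrite free_energyE -leeBrDl//; apply: ge_ereal_sup.
move=> _ [k [xi [mxi ->]]].
by rewrite -EFinB lee_fin; exact: partition_entropy_le.
Qed.

Lemma free_energy_gibbs : free_energy g nu = P%:E.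
Proof.
apply/eqP; rewrite eq_le free_energy_le//=.
rewrite free_energyE -leeBlDl//; apply: ereal_sup_ubound.
exists 2%N, first_letter; split; first exact: measurable_first_letter.
rewrite -EFinB; congr (_%:E); apply/esym/cvg_lim => //.
apply/cvgrPdist_le => e e0.
have [n0 _ n0P] : \forall n \near \oo, C / n%:R <= e.
  have /cvgrPdist_le/(_ _ e0) : C / n%:R @[n --> \oo] --> 0.
    by rewrite -(mulr0 C); apply: cvgMl_tmp; exact: cvg_invn.
  apply: filterS => n; rewrite sub0r normrN; apply: le_trans; exact: ler_norm.
exists n0.+1 => // n /= n0n; apply: le_trans (n0P n (ltnW n0n)).
have n_gt0 : 0 < n%:R :> R by rewrite ltr0n (leq_ltn_trans _ n0n).
rewrite ler_pdivlMr// distrC -[X in _ * X]ger0_norm// -normrM mulrBl divfK ?gt_eqF//.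
rewrite (join_entropy_labelling measurable_first_letter).
have := cross_entropy_gibbs n nu_inv; rewrite [n%:R * _]mulrC.
by under [X in _ -> `|- X - _| <= _]eq_Rintegral do rewrite join_atom_first_letter.
Qed.

(** A Gibbs measure for [g] with exponent [P] is an equilibrium measure. The
    cylinder weights of a Gibbs measure make a code that is efficient for every
    invariant measure, up to its integral of [g]. *)
Lemma gibbs_attains_pressure : attains_pressure g nu.
Proof.
split => //; apply/eqP; rewrite eq_le; apply/andP; split.
  by apply: ereal_sup_ubound; exists nu.
rewrite free_energy_gibbs; apply: ge_ereal_sup => _ [mu inv <-].
exact: free_energy_le.
Qed.

End gibbs.

(** * A measure with prescribed weights of cylinders *)

Section prescribed_cylinders.
Context {R : realType}.
Variable p : seq bool -> R.
Hypothesis p_ge0 : forall w, 0 <= p w.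
Hypothesis p_nil : p [::] = 1.
Hypothesis p_rcons : forall w, p w = p (rcons w false) + p (rcons w true).

(** The words of length [n] cut [`[0, 1[] into consecutive intervals
    [`[left_end w, left_end w + p w[] in lexicographic order. *)
Definition left_end (w : seq bool) : R :=
  \sum_(i < size w) if nth false w i then p (rcons (take i w) false) else 0.

Lemma left_end_rcons w s :
  left_end (rcons w s) = left_end w + if s then p (rcons w false) else 0.
Proof.
rewrite /left_end size_rcons big_ord_recr /= nth_rcons ltnn eqxx; congr (_ + _).
  apply: eq_bigr => i _; rewrite nth_rcons ltn_ord -[rcons w s]cats1 takel_cat//.
  by rewrite ltnW.
by rewrite -[rcons w s]cats1 take_size_cat.
Qed.

Lemma left_end_range w : 0 <= left_end w /\ left_end w + p w <= 1.
Proof.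
elim/last_ind: w => [|w s [lo hi]]; first by rewrite /left_end big_ord0 p_nil; lra.
have pf := p_ge0 (rcons w false); have pt := p_ge0 (rcons w true).
by move: hi; rewrite left_end_rcons p_rcons; case: s; lra.
Qed.

Fixpoint expansion (t : R) (n : nat) : seq bool :=
  if n is m.+1 then
    let w := expansion t m in rcons w (left_end w + p (rcons w false) <= t)
  else [::].

Lemma expansionP t w : 0 <= t < 1 ->
  expansion t (size w) = w <-> left_end w <= t < left_end w + p w.
Proof.
move=> t01; elim/last_ind: w => [|w s IH].
  by rewrite /left_end big_ord0 p_nil add0r.
rewrite size_rcons /= left_end_rcons; split.
  move/eqP; rewrite eqseq_rcons => /andP[/eqP ew]; rewrite ew.
  have /andP[lt tl] := IH.1 ew; move: tl; rewrite p_rcons => tl.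
  by case: s => /eqP h; apply/andP; split; lra.
move=> h; have pf := p_ge0 (rcons w false); have pt := p_ge0 (rcons w true).
have ew : expansion t (size w) = w.
  by apply/IH; rewrite p_rcons; case: s h => /andP[? ?]; apply/andP; split; lra.
by rewrite ew; congr rcons; case: s h => /andP[? ?]; apply/idP; lra.
Qed.

Lemma measurable_expansion n w :
  measurable [set t : measurableTypeR R | expansion t n = w].
Proof.
elim: n w => [|n IH] w /=.
  have [->|/eqP w0] := eqVneq w [::].
    by rewrite (_ : mkset _ = setT)//; apply/seteqP; split.
  by rewrite (_ : mkset _ = set0)//; apply/seteqP; split => // t /= /esym.
case/lastP: w => [|w s].
  rewrite (_ : mkset _ = set0)//; apply/seteqP; split => // t /=.
  by move/(congr1 size); rewrite size_rcons.
rewrite (_ : mkset _ = [set t | expansion t n = w] `&`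
    (if s then `[left_end w + p (rcons w false), +oo[%classic
     else `]-oo, left_end w + p (rcons w false)[%classic)).
  by apply: measurableI => //; case: s.
apply/seteqP; split => t /=.
  move/eqP; rewrite eqseq_rcons => /andP[/eqP ew]; rewrite ew => /eqP h.
  split=> //; move: h; case: s => /=; rewrite in_itv /= ?andbT// => /negbT.
  by rewrite -ltNge.
case=> ew; rewrite ew => h; congr rcons; move: h.
by case: s => /=; rewrite in_itv /= ?andbT// ltNge => /negbTE.
Qed.

Definition expansion_point (t : measurableTypeR R) : shift_space :=
  fun n => last false (expansion t n.+1).

Lemma pref_expansion_point n t : pref n (expansion_point t) = expansion t n.
Proof.
by elim: n => // n IH; rewrite /pref mkseqS -/(pref n _) IH /expansion_point /= last_rcons.
Qed.

Lemma measurable_expansion_point : measurable_fun [set: measurableTypeR R] expansion_point.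
Proof.
apply: (measurability _ measurable_shiftE).
move=> _ [_ [->|[w _ <-]] <-]; rewrite setTI ?preimage_set0//.
rewrite cylinderE /preimage /=.
under eq_set do rewrite pref_expansion_point.
exact: measurable_expansion.
Qed.

HB.instance Definition _ :=
  isMeasurableFun.Build _ _ _ _ expansion_point measurable_expansion_point.

(** The image of the Lebesgue measure of [`[0, 1[]. *)
Lemma exists_cylinder_probability : exists nu : probability shift_space R,
  forall w, nu (cylinder w) = (p w)%:E.
Proof.
have mI : measurable (`[0%R, 1%R[%classic : set R) by exact: measurable_itv.
pose leb : measure (measurableTypeR R) R := mrestr (@lebesgue_measure R) mI.
have leb1 : leb setT = 1%E.
  by rewrite /leb /= /mrestr setTI lebesgue_measure_itv /= lte_fin ltr01 sube0.
pose P : probability (measurableTypeR R) R := HB.pack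
  (Measure.sort leb) (Measure_isProbability.Build _ _ _ leb leb1).
exists (distribution P expansion_point) => w.
rewrite /distribution /pushforward /P /= /mrestr.
rewrite (_ : _ `&` _ = `[left_end w, left_end w + p w[%classic); last first.
  have [lo hi] := left_end_range w.
  apply/seteqP; split => t /=; rewrite cylinderE /= pref_expansion_point !in_itv /=.
    by case=> ew t01; apply/expansionP.
  move=> h; have t01 : 0 <= t < 1 by case/andP: h => ? ?; apply/andP; split; lra.
  by split=> //; apply/expansionP.
rewrite lebesgue_measure_itv /= lte_fin ltrDl.
have := p_ge0 w; rewrite le_eqVlt => /orP[/eqP <-|->]; first by rewrite ltxx.
by rewrite -EFinB addrAC subrr add0r.
Qed.

End prescribed_cylinders.

(** * Tails of series *)

Section tails.
Context {R : realType}.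
Implicit Types u v : nat -> R.

Definition tail u q : R := limn (series u) - series u q.

Lemma tailS u q : tail u q = u q + tail u q.+1.
Proof. by rewrite /tail seriesSr; ring. Qed.

Lemma tail0 u : tail u 0 = limn (series u).
Proof. by rewrite /tail seriesEnat /= big_geq ?subr0. Qed.

Lemma cvg_tail u q : cvgn (series u) ->
  series u (q + n)%N - series u q @[n --> \oo] --> tail u q.
Proof.
move=> cu; apply: cvgB; last exact: cvg_cst.
rewrite (_ : (fun n => series u (q + n)%N) = [sequence series u (n + q)%N]_n).
  by rewrite cvg_shiftn.
by apply/funext => n; rewrite addnC.
Qed.

Lemma le_tail u v q : cvgn (series u) -> cvgn (series v) ->
  (forall n, (q <= n)%N -> u n <= v n) -> tail u q <= tail v q.
Proof.
move=> cu cv uv; have tu := @cvg_tail u q cu; have tv := @cvg_tail v q cv.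
rewrite -(cvg_lim _ tu)// -(cvg_lim _ tv)//; apply: ler_lim.
- by apply/cvg_ex; exists (tail u q).
- by apply/cvg_ex; exists (tail v q).
exists 0%N => // n _ /=.
rewrite !sub_series_geq ?leq_addr//.
by rewrite !big_nat; apply: ler_sum => i /andP[qi _]; exact: uv.
Qed.

Lemma cvg_seriesZl (c : R) u : cvgn (series u) -> cvgn (series (fun n => c * u n)).
Proof.
move=> cu; rewrite (_ : series _ = fun n => c * series u n).
  by apply: is_cvgMr.
by apply/funext => n; rewrite !seriesEnat /= mulr_sumr.
Qed.

Lemma tailZl (c : R) u q : cvgn (series u) ->
  tail (fun n => c * u n) q = c * tail u q.
Proof.
move=> cu; rewrite /tail (_ : series _ = fun n => c * series u n); last first.
  by apply/funext => n; rewrite !seriesEnat /= mulr_sumr.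
rewrite mulrBr; congr (_ - _); apply: cvg_lim => //.
exact: cvgMl_tmp.
Qed.

Lemma cvg_seriesD u v : cvgn (series u) -> cvgn (series v) ->
  cvgn (series (fun n => u n + v n)).
Proof.
move=> cu cv; rewrite (_ : series _ = fun n => series u n + series v n).
  exact: is_cvgD.
by apply/funext => n; rewrite !seriesEnat /= big_split.
Qed.

Lemma tailD u v q : cvgn (series u) -> cvgn (series v) ->
  tail (fun n => u n + v n) q = tail u q + tail v q.
Proof.
move=> cu cv; rewrite /tail (_ : series _ = fun n => series u n + series v n); last first.
  by apply/funext => n; rewrite !seriesEnat /= big_split.
rewrite addrACA -opprD; congr (_ - _); apply: cvg_lim => //.
exact: cvgD.
Qed.

Lemma cvg_geometric01 (z : R) : 0 <= z < 1 -> cvgn (series (fun n => z ^+ n)).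
Proof.
case/andP=> z0 z1; rewrite (_ : (fun n => z ^+ n) = geometric 1 z).
  by apply: is_cvg_geometric_series; rewrite ger0_norm.
by apply/funext => n; rewrite /geometric /= mul1r.
Qed.

Lemma tail_geometric (z : R) q : 0 <= z < 1 ->
  tail (fun n => z ^+ n) q = z ^+ q / (1 - z).
Proof.
case/andP=> z0 z1; have z10 : 1 - z != 0 by rewrite subr_eq0 gt_eqF.
elim: q => [|q IH].
  rewrite tail0 expr0; apply: cvg_lim => //.
  rewrite (_ : (fun n => z ^+ n) = geometric 1 z).
    by apply: cvg_geometric_series; rewrite ger0_norm.
  by apply/funext => n; rewrite /geometric /= mul1r.
have : tail (fun n => z ^+ n) q.+1 = z ^+ q / (1 - z) - z ^+ q.
  by rewrite -IH [tail _ q]tailS; ring.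
by move=> ->; rewrite exprS; field.
Qed.

Lemma cvg_series_le u v : (forall n, 0 <= u n) -> (forall n, u n <= v n) ->
  cvgn (series v) -> cvgn (series u).
Proof.
move=> u0 uv; apply: series_le_cvg => // n; exact: le_trans (u0 n) (uv n).
Qed.

End tails.

(** * Stationary alternating renewal processes *)

Section renewal.
Context {R : realType}.

(** Blocks of [r + 1] symbols [s] occur with probability [wt s r], the lengths
    of successive blocks being independent; [T s r] and [V s r] are the first
    and second tail sums of [wt s]. *)
Variables (wt T V : bool -> nat -> R).
Hypothesis wt_gt0 : forall s r, 0 < wt s r.
Hypothesis T_gt0 : forall s r, 0 < T s r.
Hypothesis V_gt0 : forall s r, 0 < V s r.
Hypothesis T0 : forall s, T s 0 = 1.
Hypothesis TE : forall s r, T s r = wt s r + T s r.+1.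
Hypothesis VE : forall s r, V s r = T s r + V s r.+1.

(** The probability that a block which begins with [r + 1] symbols [s]
    continues with the word [w]. *)
Fixpoint inner (s : bool) (r : nat) (w : seq bool) : R :=
  if w is x :: w' then
    if x == s then inner s r.+1 w' else wt s r * inner x 0 w'
  else T s r.

(** The same when the first block may have begun earlier; the total mass, which
    is the mean length of two successive blocks, is [period]. *)
Fixpoint outer (s : bool) (r : nat) (w : seq bool) : R :=
  if w is x :: w' then
    if x == s then outer s r.+1 w' else T s r * inner x 0 w'
  else V s r.

Definition period : R := V false 0 + V true 0.

Definition weight (w : seq bool) : R :=
  if w is x :: w' then outer x 0 w' / period else 1.

Lemma period_gt0 : 0 < period.
Proof. by rewrite /period addr_gt0. Qed.

Lemma inner_rcons s r w :
  inner s r w = inner s r (rcons w false) + inner s r (rcons w true).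
Proof.
elim: w s r => [|x w IH] s r /=.
  by case: s; rewrite /= !T0 !mulr1 TE // addrC.
by case: eqP => _; rewrite IH// mulrDr.
Qed.

Lemma outer_rcons s r w :
  outer s r w = outer s r (rcons w false) + outer s r (rcons w true).
Proof.
elim: w s r => [|x w IH] s r /=.
  by case: s; rewrite /= !T0 !mulr1 VE // addrC.
by case: eqP => _; rewrite ?IH// -mulrDr -inner_rcons.
Qed.

Lemma outer_inner s r w : outer s r w = inner s r w + outer s r.+1 w.
Proof.
elim: w s r => [|x w IH] s r /=; first exact: VE.
by case: eqP => _ //; rewrite TE mulrDl.
Qed.

Lemma weight_rcons w : weight w = weight (rcons w false) + weight (rcons w true).
Proof.
case: w => [|x w] /=; last by rewrite -mulrDl -outer_rcons.
by rewrite -mulrDl divff// gt_eqF// period_gt0.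
Qed.

Lemma weight_cons w : weight w = weight (false :: w) + weight (true :: w).
Proof.
case: w => [|x w] /=; first by rewrite -mulrDl divff// gt_eqF// period_gt0.
by rewrite -mulrDl outer_inner; case: x; rewrite /= T0 mul1r// addrC.
Qed.

Lemma inner_gt0 s r w : 0 < inner s r w.
Proof.
elim: w s r => [|x w IH] s r /=; first exact: T_gt0.
by case: ifP => _ //; exact: mulr_gt0.
Qed.

Lemma outer_gt0 s r w : 0 < outer s r w.
Proof.
elim: w s r => [|x w IH] s r /=; first exact: V_gt0.
by case: ifP => _ //; rewrite mulr_gt0// inner_gt0.
Qed.

Lemma weight_gt0 w : 0 < weight w.
Proof.
by case: w => [|x w] /=; rewrite ?ltr01// divr_gt0 ?outer_gt0 ?period_gt0.
Qed.

(** Tail sums give the consistency [weight_rcons], which makes [weight] a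
    measure, and [weight_cons], which makes it shift invariant. *)
Lemma exists_renewal_measure : exists nu : probability shift_space R,
  shift_invariant nu /\ forall w, nu (cylinder w) = (weight w)%:E.
Proof.
have [nu nuE] := exists_cylinder_probability (fun w => ltW (weight_gt0 w)) erefl weight_rcons.
have nuS w : nu (shift_map @^-1` cylinder w) = nu (cylinder w).
  rewrite cylinder_preimage nuE weight_cons EFinD -!nuE.
  apply: measureU; [exact: measurable_cylinder|exact: measurable_cylinder|].
  exact: cylinder_preimage_disjoint.
exists nu; split=> // A mA.
apply: (@eq_measure_cylinder R (distribution nu shift_map) nu) => //.
by rewrite -ge0_fin_numE// fin_num_measure.
Qed.

End renewal.

(** * Potentials that depend on the length of the first block *)

Lemma concat_nseq_const n s : concat (nseq n s) (const_point s) = const_point s.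
Proof.
apply/funext => i; rewrite /concat size_nseq nth_nseq /const_point.
by case: ltnP.
Qed.

Lemma const_or_run s (x : shift_space) :
  x = const_point s \/ exists k z, x = concat (rcons (nseq k s) (~~ s)) z.
Proof.
have [h|nh] := pselect (exists i, x i != s); last first.
  left; apply/funext => i; apply/eqP/negPn/negP => xi; apply: nh.
  by exists i.
right; case: (ex_minnP h) => k xk mink; exists k, (iter k.+1 shift_map x).
rewrite -[LHS](concat_pref k.+1); congr concat.
rewrite /pref mkseqS; congr rcons; last by move: xk; case: (x k); case: s {h mink}.
apply: (@eq_from_nth _ false); rewrite size_pref ?size_nseq// => i ik.
rewrite nth_pref// nth_nseq ik; apply/eqP/negPn/negP => /mink.
by rewrite leqNgt ik.
Qed.

Section energy.
Context {R : realType}.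
Variable coef : bool -> nat -> R.
Hypothesis coef_lt0 : forall s n, coef s n < 0.
Hypothesis coef_sum : forall s, cvgn (series (coef s)).

(** For the coefficients of a potential, this is its Birkhoff sum along a complete
    block of [n] symbols [s]. *)
Definition energy s n : R := series (coef s) n.

Definition energy_inf s : R := limn (series (coef s)).

Lemma energyS s n : energy s n.+1 = energy s n + coef s n.
Proof. by rewrite /energy seriesSr. Qed.

Lemma energy0 s : energy s 0 = 0.
Proof. by rewrite /energy seriesEnat /= big_geq. Qed.

Lemma energy1 s : energy s 1 = coef s 0.
Proof. by rewrite energyS energy0 add0r. Qed.

Lemma cvg_energy s : energy s n @[n --> \oo] --> energy_inf s.
Proof. exact: coef_sum. Qed.

Lemma energy_le s m n : (m <= n)%N -> energy s n <= energy s m.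
Proof.
move=> mn; rewrite -(subnKC mn); elim: (n - m)%N => [|k IH]; first by rewrite addn0.
by rewrite addnS energyS; rewrite (le_trans _ IH)// gerDl ltW.
Qed.

Lemma energy_inf_le s n : energy_inf s <= energy s n.
Proof.
by apply: nonincreasing_cvgn_ge => [m k|]; [exact: energy_le|exact: coef_sum].
Qed.

Lemma energy_inf_lt0 s : energy_inf s < 0.
Proof.
by apply: le_lt_trans (energy_inf_le s 1) _; rewrite energyS energy0 add0r.
Qed.

End energy.

Section potential.
Context {R : realType}.
Variables (f : shift_space -> R) (coef : bool -> nat -> R).
Hypothesis coef_lt0 : forall s n, coef s n < 0.
Hypothesis f_run : forall s n z,
  f (concat (rcons (nseq n.+1 s) (~~ s)) z) = coef s n.
Hypothesis f_const : forall s, f (const_point s) = 0.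

(** The points [s^(n+1) (~~s) z] and [s^oo] are within [theta ^ (n+1)]. *)
Lemma coef_summable (theta : R) s :
  0 < theta < 1 -> Lipschitz theta f -> cvgn (series (coef s)).
Proof.
move=> theta01 [L fL]; have /andP[t0 t1] := theta01.
have t01 : 0 <= theta < 1 by rewrite ltW.
have bound n : - coef s n <= `|L| * theta ^+ n.
  pose x := concat (rcons (nseq n.+1 s) (~~ s)) (const_point false).
  rewrite -(f_run s n (const_point false)) -/x.
  apply: le_trans (ler_norm _) _; rewrite normrN -[f x]subr0 -(f_const s).
  apply: le_trans (fL _ _) _; apply: le_trans (ler_norm _) _.
  rewrite normrM ler_wpM2l//.
  have d0 : 0 <= theta_dist theta x (const_point s).
    by rewrite /theta_dist; case: pselect => // h; rewrite exprn_ge0// ltW.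
  rewrite ger0_norm// ltW//; apply/theta_dist_lt => // i ni.
  rewrite /x /concat size_rcons size_nseq ltnW ?ltnS 1?ltnW//.
  by rewrite nth_rcons size_nseq ltnW// nth_nseq ltnW.
have cN : cvgn (series (fun n => - coef s n)).
  apply: (cvg_series_le _ bound); first by move=> n; rewrite oppr_ge0 ltW.
  exact/cvg_seriesZl/cvg_geometric01.
have := @cvg_seriesZl R (-1) _ cN.
by under [X in series X]eq_fun do rewrite mulN1r opprK.
Qed.

Lemma f_le0 x : f x <= 0.
Proof.
have [->|[[|k] [z xz]]] := const_or_run (x 0%N) x; first by rewrite f_const.
- by move: (congr1 (@^~ 0%N) xz); rewrite /= concat_cons; case: (x 0%N).
- by rewrite xz f_run ltW.
Qed.

Lemma birkhoff_sum_const n s : birkhoff_sum f n (const_point s) = 0.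
Proof.
elim: n => [|n IH]; first by rewrite /birkhoff_sum big_ord0.
by rewrite birkhoff_sumS f_const add0r -[RHS]IH.
Qed.

Lemma birkhoff_sum_run n m s z :
  birkhoff_sum f (n + m) (concat (rcons (nseq n s) (~~ s)) z) =
  energy coef s n + birkhoff_sum f m (concat [:: ~~ s] z).
Proof.
elim: n => [|n IH]; first by rewrite energy0 add0r.
rewrite addSn birkhoff_sumS f_run [nseq _ _]/= rcons_cons shift_concat_cons IH.
by rewrite energyS; ring.
Qed.

Lemma birkhoff_sum_in_run n k s z :
  birkhoff_sum f n (concat (rcons (nseq (n + k) s) (~~ s)) z) =
  energy coef s (n + k) - energy coef s k.
Proof.
elim: n => [|n IH]; first by rewrite subrr /birkhoff_sum big_ord0.
rewrite birkhoff_sumS f_run [nseq _ _]/= rcons_cons shift_concat_cons IH.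
by rewrite addSn energyS; ring.
Qed.

Hypothesis coef_sum : forall s, cvgn (series (coef s)).

(** An incomplete block contributes a sum of consecutive coefficients, which lies
    between [energy_inf s] and [0]: this is the bounded distortion of [f]. *)
Lemma birkhoff_sum_block n s y :
  energy_inf coef s <= birkhoff_sum f n (concat (nseq n s) y) <= 0.
Proof.
apply/andP; split; last by apply: sumr_le0 => i _; exact: f_le0.
have [->|[k [z ->]]] := const_or_run s y.
  by rewrite concat_nseq_const birkhoff_sum_const; exact/ltW/(energy_inf_lt0 coef_lt0 coef_sum).
have e : concat (nseq n s) (concat (rcons (nseq k s) (~~ s)) z) =
    concat (rcons (nseq (n + k) s) (~~ s)) z.
  by rewrite nseqD rcons_cat concat_cat.
rewrite e birkhoff_sum_in_run lerBrDr.
have := energy_inf_le coef_lt0 coef_sum s (n + k); have := energy_le coef_lt0 s (leq0n k).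
rewrite energy0; lra.
Qed.

End potential.

(** * The Gibbs measure *)

Section block_weights.
Context {R : realType}.
Variable coef : bool -> nat -> R.
Variables (beta z : R).

(** The Gibbs weight of a block of [r + 1] symbols [s], with pressure [- ln z]. *)
Definition boltz s r : R := expR (beta * energy coef s r.+1) * z ^+ r.+1.

Definition boltz_sum s : R := tail (boltz s) 0.

Definition block_prob s r : R := boltz s r / boltz_sum s.

Definition block_tail s r : R := tail (boltz s) r / boltz_sum s.

Definition block_tail2 s r : R := tail (tail (boltz s)) r / boltz_sum s.

Hypothesis coef_lt0 : forall s n, coef s n < 0.
Hypothesis coef_sum : forall s, cvgn (series (coef s)).
Hypothesis beta_gt0 : 0 < beta.
Hypothesis z01 : 0 < z < 1.

Let z_gt0 : 0 < z. Proof. by case/andP: z01. Qed.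
Let z_ge0 : 0 <= z. Proof. exact: ltW. Qed.
Let z_lt1 : z < 1. Proof. by case/andP: z01. Qed.
Let zr01 : 0 <= z < 1. Proof. by rewrite ltW. Qed.
Let z1_gt0 : 0 < 1 - z. Proof. by rewrite subr_gt0. Qed.

Lemma boltz_gt0 s r : 0 < boltz s r.
Proof. by rewrite mulr_gt0 ?expR_gt0 ?exprn_gt0. Qed.

Lemma boltz_le s r : boltz s r <= z * z ^+ r.
Proof.
rewrite /boltz -exprS ler_piMl ?exprn_ge0// -expR0 ler_expR.
rewrite pmulr_rle0//; have := energy_le coef_lt0 s (leq0n r.+1).
by rewrite energy0.
Qed.

Lemma boltz_ge s r : expR (beta * energy_inf coef s) * z * z ^+ r <= boltz s r.
Proof.
rewrite /boltz -mulrA -exprS ler_wpM2r ?exprn_ge0// ler_expR ler_wpM2l ?(ltW beta_gt0)//.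
exact: energy_inf_le.
Qed.

Lemma cvg_boltz s : cvgn (series (boltz s)).
Proof.
apply: cvg_series_le (boltz_le s) _; first by move=> r; exact/ltW/boltz_gt0.
exact/cvg_seriesZl/cvg_geometric01.
Qed.

Lemma tail_boltz_le s q : tail (boltz s) q <= z / (1 - z) * z ^+ q.
Proof.
rewrite mulrAC -mulrA -tail_geometric// -tailZl; last exact: cvg_geometric01.
apply: le_tail => [||n _]; [exact: cvg_boltz| |exact: boltz_le].
exact/cvg_seriesZl/cvg_geometric01.
Qed.

Lemma tail_boltz_ge s q :
  expR (beta * energy_inf coef s) * (z / (1 - z)) * z ^+ q <= tail (boltz s) q.
Proof.
rewrite mulrA mulrAC -mulrA -tail_geometric// -tailZl; last exact: cvg_geometric01.
apply: le_tail => [||n _]; [|exact: cvg_boltz|exact: boltz_ge].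
exact/cvg_seriesZl/cvg_geometric01.
Qed.

Lemma tail_boltz_gt0 s q : 0 < tail (boltz s) q.
Proof.
by apply: lt_le_trans (tail_boltz_ge s q); rewrite !mulr_gt0 ?invr_gt0 ?exprn_gt0 ?expR_gt0.
Qed.

Lemma cvg_tail_boltz s : cvgn (series (tail (boltz s))).
Proof.
apply: cvg_series_le (tail_boltz_le s) _; first by move=> r; exact/ltW/tail_boltz_gt0.
exact/cvg_seriesZl/cvg_geometric01.
Qed.

Lemma tail2_boltz_le s q : tail (tail (boltz s)) q <= z / (1 - z) ^+ 2 * z ^+ q.
Proof.
have -> : z / (1 - z) ^+ 2 * z ^+ q = z / (1 - z) * (z ^+ q / (1 - z)).
  by field; rewrite gt_eqF.
rewrite -tail_geometric// -tailZl; last exact: cvg_geometric01.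
apply: le_tail => [||n _]; [exact: cvg_tail_boltz| |exact: tail_boltz_le].
exact/cvg_seriesZl/cvg_geometric01.
Qed.

Lemma tail2_boltz_ge s q :
  expR (beta * energy_inf coef s) * (z / (1 - z) ^+ 2) * z ^+ q <=
  tail (tail (boltz s)) q.
Proof.
have -> : expR (beta * energy_inf coef s) * (z / (1 - z) ^+ 2) * z ^+ q =
    expR (beta * energy_inf coef s) * (z / (1 - z)) * (z ^+ q / (1 - z)).
  by field; rewrite gt_eqF.
rewrite -tail_geometric// -tailZl; last exact: cvg_geometric01.
apply: le_tail => [||n _]; [|exact: cvg_tail_boltz|exact: tail_boltz_ge].
exact/cvg_seriesZl/cvg_geometric01.
Qed.

Lemma boltz_sum_gt0 s : 0 < boltz_sum s. Proof. exact: tail_boltz_gt0. Qed.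

Lemma block_prob_gt0 s r : 0 < block_prob s r.
Proof. by rewrite divr_gt0 ?boltz_gt0 ?boltz_sum_gt0. Qed.

Lemma block_tail_gt0 s r : 0 < block_tail s r.
Proof. by rewrite divr_gt0 ?tail_boltz_gt0 ?boltz_sum_gt0. Qed.

Lemma block_tail2_gt0 s r : 0 < block_tail2 s r.
Proof.
apply: divr_gt0; last exact: boltz_sum_gt0.
apply: lt_le_trans (tail2_boltz_ge s r).
by rewrite !mulr_gt0 ?invr_gt0 ?exprn_gt0 ?expR_gt0.
Qed.

Lemma block_tail0 s : block_tail s 0 = 1.
Proof. by rewrite /block_tail divff// gt_eqF// boltz_sum_gt0. Qed.

Lemma block_tailE s r : block_tail s r = block_prob s r + block_tail s r.+1.
Proof. by rewrite /block_tail tailS mulrDl. Qed.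

Lemma block_tail2E s r : block_tail2 s r = block_tail s r + block_tail2 s r.+1.
Proof. by rewrite /block_tail2 tailS mulrDl. Qed.

Definition gibbs_inner := inner block_prob block_tail.
Definition gibbs_outer := outer block_prob block_tail block_tail2.
Definition gibbs_weight := weight block_prob block_tail block_tail2.

Variable f : shift_space -> R.
Hypothesis f_run : forall s n z,
  f (concat (rcons (nseq n.+1 s) (~~ s)) z) = coef s n.
Hypothesis f_const : forall s, f (const_point s) = 0.
Hypothesis boltz_sum1 : boltz_sum false * boltz_sum true = 1.

(** A coboundary that absorbs the normalizations of the blocks, whose product
    over two successive blocks is [1]. *)
Definition normalization s : R := if s then ln (boltz_sum false) else 0.

Lemma normalization_step s :
  normalization s = normalization (~~ s) - ln (boltz_sum s).
Proof.
have := congr1 (@ln R) boltz_sum1; rewrite lnM ?posrE ?boltz_sum_gt0// ln1.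
by rewrite /normalization; case: s => /= h; lra.
Qed.

Definition defect (p : R) n x : R :=
  ln p - (beta * birkhoff_sum f n x + n%:R * ln z).

Lemma ln_tail_boltz s r :
  beta * energy_inf coef s <=
    ln (tail (boltz s) r) - r.+1%:R * ln z + ln (1 - z) <= 0.
Proof.
have lnle : ln (tail (boltz s) r) <= ln (z / (1 - z) * z ^+ r).
  rewrite ler_ln ?posrE ?tail_boltz_gt0 ?tail_boltz_le//.
  by rewrite !mulr_gt0 ?invr_gt0 ?exprn_gt0.
have lnge : ln (expR (beta * energy_inf coef s) * (z / (1 - z)) * z ^+ r) <=
    ln (tail (boltz s) r).
  rewrite ler_ln ?posrE ?tail_boltz_gt0 ?tail_boltz_ge//.
  by rewrite !mulr_gt0 ?invr_gt0 ?exprn_gt0 ?expR_gt0.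
move: lnle lnge.
have e : ln (z / (1 - z) * z ^+ r) = r.+1%:R * ln z - ln (1 - z).
  rewrite mulrAC -exprS ln_div ?posrE ?exprn_gt0// lnXn//.
  by rewrite mulr_natl.
rewrite e -[expR _ * _ * _]mulrA lnM ?posrE ?expR_gt0 ?mulr_gt0 ?invr_gt0 ?exprn_gt0//.
rewrite expRK e.
by move=> ? ?; apply/andP; split; lra.
Qed.

Lemma ln_tail2_boltz s r :
  beta * energy_inf coef s <=
    ln (tail (tail (boltz s)) r) - r.+1%:R * ln z + 2 * ln (1 - z) <= 0.
Proof.
have lnle : ln (tail (tail (boltz s)) r) <= ln (z / (1 - z) ^+ 2 * z ^+ r).
  rewrite ler_ln ?posrE ?tail2_boltz_le//.
    by apply: lt_le_trans (tail2_boltz_ge s r);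
      rewrite !mulr_gt0 ?invr_gt0 ?exprn_gt0 ?expR_gt0.
  by rewrite !mulr_gt0 ?invr_gt0 ?exprn_gt0.
have lnge : ln (expR (beta * energy_inf coef s) * (z / (1 - z) ^+ 2) * z ^+ r) <=
    ln (tail (tail (boltz s)) r).
  rewrite ler_ln ?posrE ?tail2_boltz_ge//.
    by rewrite !mulr_gt0 ?invr_gt0 ?exprn_gt0 ?expR_gt0.
  by apply: lt_le_trans (tail2_boltz_ge s r);
      rewrite !mulr_gt0 ?invr_gt0 ?exprn_gt0 ?expR_gt0.
move: lnle lnge.
have e : ln (z / (1 - z) ^+ 2 * z ^+ r) = r.+1%:R * ln z - 2 * ln (1 - z).
  rewrite mulrAC -exprS ln_div ?posrE ?exprn_gt0// !lnXn//.
  by rewrite !mulr_natl.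
rewrite e -[expR _ * _ * _]mulrA lnM ?posrE ?expR_gt0 ?mulr_gt0 ?invr_gt0 ?exprn_gt0//.
rewrite expRK e.
by move=> ? ?; apply/andP; split; lra.
Qed.

Definition distortion : R := \sum_(s : bool)
  (`|ln (boltz_sum s)| + `|normalization s| + `|beta * energy_inf coef s|)
  + 2 * `|ln (1 - z)|.

Lemma distortion_ge s :
  `|ln (boltz_sum s)| + `|normalization s| + `|beta * energy_inf coef s|
  + 2 * `|ln (1 - z)| <= distortion.
Proof.
by rewrite /distortion lerD2r (bigD1 s)//= lerDl sumr_ge0.
Qed.

Lemma birkhoff_block_bound s n y :
  beta * energy_inf coef s <= beta * birkhoff_sum f n (concat (nseq n s) y) <= 0.
Proof.
have /andP[h1 h2] := birkhoff_sum_block coef_lt0 f_run f_const coef_sum n s y.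
by rewrite ler_wpM2l ?(ltW beta_gt0)//= pmulr_rle0.
Qed.

Lemma birkhoff_sum_block_cat r m s x y : x = ~~ s ->
  birkhoff_sum f (r.+1 + m.+1) (concat (nseq r.+1 s) (concat [:: x] y)) =
  energy coef s r.+1 + birkhoff_sum f m.+1 (concat [:: x] y).
Proof.
by move=> ->; rewrite -(birkhoff_sum_run f_run) -cats1 concat_cat.
Qed.

Lemma concat_nseq_head r s y : y 0%N = s ->
  concat (nseq r.+1 s) y = concat (nseq r.+2 s) (shift_map y).
Proof.
move=> ys; rewrite -{1}(concat_head_shift y) ys -concat_cat.
by rewrite (_ : [:: s] = nseq 1 s)// -nseqD addn1.
Qed.

Lemma ln_block_prob s r :
  ln (block_prob s r) =
  beta * energy coef s r.+1 + r.+1%:R * ln z - ln (boltz_sum s).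
Proof.
rewrite ln_div ?posrE ?boltz_gt0 ?boltz_sum_gt0//; congr (_ - _).
by rewrite lnM ?posrE ?expR_gt0 ?exprn_gt0// expRK lnXn// mulr_natl.
Qed.

Lemma normr_bounds (a : R) : - `|a| <= a <= `|a|.
Proof. by rewrite -ler_norml. Qed.

(** Both [defect] and the recursion for [gibbs_inner] are additive over complete
    blocks, so the only error comes from the last, incomplete one. *)
Lemma inner_defect s r w y : pref (size w) y = w ->
  `|defect (gibbs_inner s r w) (r.+1 + size w) (concat (nseq r.+1 s) y)
    - normalization s| <= distortion.
Proof.
elim: w s r y => [|x w IH] s r y.
  move=> _; rewrite addn0 /defect /=.
  rewrite ln_div ?posrE ?tail_boltz_gt0 ?boltz_sum_gt0//.
  have /andP[? ?] := ln_tail_boltz s r.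
  have /andP[? ?] := birkhoff_block_bound s r.+1 y.
  have /andP[? ?] := normr_bounds (ln (boltz_sum s)).
  have /andP[? ?] := normr_bounds (normalization s).
  have /andP[? ?] := normr_bounds (beta * energy_inf coef s).
  have /andP[? ?] := normr_bounds (ln (1 - z)).
  have ? := distortion_ge s.
  rewrite ler_norml; apply/andP; split; lra.
rewrite [size _]/= prefS => -[yx yw] /=; case: eqP => [xs|/eqP xs].
  by rewrite -addSnnS concat_nseq_head ?yx//; exact: IH.
have {}xs : x = ~~ s by case: x s xs {IH yx} => -[].
apply: le_trans (IH x 0%N _ yw); rewrite le_eqVlt; apply/orP; left; apply/eqP.
congr `| _ |; rewrite /defect lnM ?posrE ?block_prob_gt0//; last first.
  by apply: inner_gt0; [exact: block_prob_gt0|exact: block_tail_gt0].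
rewrite -{1}(concat_head_shift y) yx birkhoff_sum_block_cat// ln_block_prob.
rewrite (normalization_step s) -xs add1n natrD -/gibbs_inner.
by rewrite (_ : nseq 1 x = [:: x])//; ring.
Qed.

Lemma outer_defect s r w y : pref (size w) y = w ->
  `|defect (gibbs_outer s r w) (r.+1 + size w) (concat (nseq r.+1 s) y)|
    <= 3 * distortion.
Proof.
elim: w s r y => [|x w IH] s r y.
  move=> _; rewrite addn0 /defect /=.
  have F0 := boltz_sum_gt0 s.
  have t0 : 0 < tail (tail (boltz s)) r.
    by have := block_tail2_gt0 s r; rewrite pmulr_lgt0 ?invr_gt0.
  rewrite ln_div ?posrE//.
  have /andP[? ?] := ln_tail2_boltz s r.
  have /andP[? ?] := birkhoff_block_bound s r.+1 y.
  have /andP[? ?] := normr_bounds (ln (boltz_sum s)).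
  have /andP[? ?] := normr_bounds (beta * energy_inf coef s).
  have /andP[? ?] := normr_bounds (ln (1 - z)).
  have := normr_ge0 (normalization s).
  have ? := distortion_ge s.
  rewrite ler_norml => ?; apply/andP; split; lra.
rewrite [size _]/= prefS => -[yx yw] /=; case: eqP => [xs|/eqP xs].
  by rewrite -addSnnS concat_nseq_head ?yx//; exact: IH.
have {}xs : x = ~~ s by case: x s xs {IH yx} => -[].
have := inner_defect x 0 yw; rewrite /defect lnM ?posrE ?block_tail_gt0//; last first.
  by apply: inner_gt0; [exact: block_prob_gt0|exact: block_tail_gt0].
rewrite -{2}(concat_head_shift y) yx birkhoff_sum_block_cat//.
rewrite add1n natrD -/gibbs_inner (_ : nseq 1 x = [:: x])//.
rewrite ln_div ?posrE ?tail_boltz_gt0 ?boltz_sum_gt0//.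
have /andP[? ?] := ln_tail_boltz s r.
have ? : beta * energy_inf coef s <= beta * energy coef s r.+1.
  by rewrite ler_wpM2l ?(ltW beta_gt0) ?energy_inf_le.
have ? : beta * energy coef s r.+1 <= 0.
  by rewrite pmulr_rle0//; have := energy_le coef_lt0 s (leq0n r.+1); rewrite energy0.
have /andP[? ?] := normr_bounds (ln (boltz_sum s)).
have /andP[? ?] := normr_bounds (normalization x).
have /andP[? ?] := normr_bounds (beta * energy_inf coef s).
have /andP[? ?] := normr_bounds (ln (1 - z)).
have := normr_ge0 (normalization s).
have := normr_ge0 (ln (boltz_sum x)).
have := normr_ge0 (beta * energy_inf coef x).
have ? := distortion_ge s.
have ? := distortion_ge x.
move=> ? ? ?; rewrite !ler_norml => /andP[? ?]; apply/andP; split; lra.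
Qed.

Lemma gibbs_weight_gt0 w : 0 < gibbs_weight w.
Proof.
apply: weight_gt0; [exact: block_prob_gt0|exact: block_tail_gt0|].
exact: block_tail2_gt0.
Qed.

Lemma gibbs_weight_defect : exists C, forall n x,
  `|ln (gibbs_weight (pref n x)) -
    (birkhoff_sum (fun x => beta * f x) n x - n%:R * - ln z)| <= C.
Proof.
have p0 : 0 < period block_tail2 by apply: period_gt0; exact: block_tail2_gt0.
have D0 : 0 <= distortion by apply: le_trans (distortion_ge true); rewrite !addr_ge0 ?mulr_ge0.
exists (3 * distortion + `|ln (period block_tail2)|) => -[|n] x.
  by rewrite /birkhoff_sum big_ord0 ln1 mul0r !subr0 normr0 addr_ge0 ?mulr_ge0.
rewrite prefS /gibbs_weight /weight -/gibbs_outer.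
have := @outer_defect (x 0%N) 0 (pref n (shift_map x)) (shift_map x).
rewrite size_pref => /(_ erefl); rewrite /defect concat_head_shift add1n.
rewrite ln_div ?posrE//; last first.
  by apply: outer_gt0; [exact: block_prob_gt0|exact: block_tail_gt0|exact: block_tail2_gt0].
have -> : birkhoff_sum (fun x => beta * f x) n.+1 x = beta * birkhoff_sum f n.+1 x.
  by rewrite /birkhoff_sum mulr_sumr.
have /andP[? ?] := normr_bounds (ln (period block_tail2)).
rewrite !ler_norml => /andP[? ?]; apply/andP; split; lra.
Qed.

End block_weights.

(** * The pressure equation *)

Section pressure_equation.
Context {R : realType}.
Variable coef : bool -> nat -> R.
Variable beta : R.
Hypothesis coef_lt0 : forall s n, coef s n < 0.
Hypothesis coef_sum : forall s, cvgn (series (coef s)).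
Hypothesis beta_gt0 : 0 < beta.

Lemma boltz_sum_at0 s : boltz_sum coef beta 0 s = 0.
Proof.
rewrite /boltz_sum tail0 (_ : series _ = fun=> 0) ?lim_cst//.
by apply/funext => n; rewrite seriesEnat /= big1// => i _; rewrite /boltz expr0n mulr0.
Qed.

(** The increments of [boltz_sum] are at most those of the geometric series
    [z / (1 - z)], as the coefficients [expR (beta * energy)] are in [[0, 1]]. *)
Lemma boltz_sum_increment s (x y : R) : 0 < x -> x <= y -> y < 1 ->
  boltz_sum coef beta x s <= boltz_sum coef beta y s <=
  boltz_sum coef beta x s + (y / (1 - y) - x / (1 - x)).
Proof.
move=> x0 xy y1; have x1 := le_lt_trans xy y1; have y0 := lt_le_trans x0 xy.
have x01 : 0 < x < 1 by rewrite x0.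
have y01 : 0 < y < 1 by rewrite y0.
have cx : cvgn (series (boltz coef beta x s)) by exact: cvg_boltz.
have cy : cvgn (series (boltz coef beta y s)) by exact: cvg_boltz.
have gx : 0 <= x < 1 by rewrite ltW.
have gy : 0 <= y < 1 by rewrite ltW.
have xyX r : x ^+ r.+1 <= y ^+ r.+1 by rewrite lerXn2r// nnegrE ltW.
apply/andP; split.
  apply: le_tail => // r _; apply: ler_wpM2l => //; exact: expR_ge0.
have tg (u : R) : 0 <= u < 1 -> tail (fun r => u * u ^+ r) 0 = u / (1 - u).
  by move=> u01; rewrite tailZl ?tail_geometric// ?expr0 ?mul1r//; exact: cvg_geometric01.
have cg (u : R) : 0 <= u < 1 -> cvgn (series (fun r => u * u ^+ r)).
  by move=> u01; exact/cvg_seriesZl/cvg_geometric01.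
have cgx := cg x gx; have cgy := cg y gy.
rewrite addrA lerBrDr -(tg _ gx) -(tg _ gy) -!tailD//.
apply: le_tail => [||r _]; [exact: cvg_seriesD|exact: cvg_seriesD|].
have := boltz_le coef_lt0 beta_gt0 y01 s r; rewrite /boltz -!exprS.
have e1 : expR (beta * energy coef s r.+1) <= 1.
  rewrite -expR0 ler_expR pmulr_rle0//.
  by have := energy_le coef_lt0 s (leq0n r.+1); rewrite energy0.
have := xyX r; set E := expR _ in e1 *; set a := x ^+ _; set b := y ^+ _ => ab _.
have : 0 <= (1 - E) * (b - a) by rewrite mulr_ge0// subr_ge0.
nra.
Qed.

Lemma boltz_sum_lipschitz s (r x y : R) : r < 1 -> 0 <= x -> x <= y -> y <= r ->
  `|boltz_sum coef beta x s - boltz_sum coef beta y s| <= (y - x) / (1 - r) ^+ 2.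
Proof.
move=> r1 x0 xy yr; have y1 := le_lt_trans yr r1; have x1 := le_lt_trans xy y1.
have r10 : 0 < (1 - r) ^+ 2 by rewrite exprn_gt0// subr_gt0.
have incr : boltz_sum coef beta x s <= boltz_sum coef beta y s <=
    boltz_sum coef beta x s + (y / (1 - y) - x / (1 - x)).
  move: x0; rewrite le_eqVlt => /orP[/eqP x0|x0]; last exact: boltz_sum_increment.
  rewrite -x0 boltz_sum_at0 mul0r subr0 add0r.
  move: xy; rewrite -x0 le_eqVlt => /orP[/eqP <-|y0].
    by rewrite boltz_sum_at0 mul0r lexx.
  have y01 : 0 < y < 1 by rewrite y0.
  rewrite ltW ?boltz_sum_gt0//=.
  by have := tail_boltz_le coef_lt0 beta_gt0 y01 s 0; rewrite expr0 mulr1.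
have /andP[h1 h2] := incr; rewrite distrC ger0_norm ?subr_ge0//.
apply: (@le_trans _ _ ((y - x) / ((1 - y) * (1 - x)))).
  have -> : (y - x) / ((1 - y) * (1 - x)) = y / (1 - y) - x / (1 - x).
    by field; rewrite !gt_eqF//= subr_gt0.
  by rewrite lerBlDl.
rewrite ler_wpM2l ?subr_ge0// lef_pV2 ?posrE ?mulr_gt0 ?subr_gt0//.
by rewrite expr2 ler_pM ?subr_ge0 ?(ltW r1)//; lra.
Qed.

Lemma boltz_sum_continuous s (r : R) : r < 1 ->
  {within `[0, r], continuous (fun x => boltz_sum coef beta x s)}.
Proof.
move=> r1; have r10 : 0 < (1 - r) ^+ 2 by rewrite exprn_gt0// subr_gt0.
apply/subspace_continuousP => x; rewrite /= in_itv /= => /andP[x0 xr].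
apply/cvgrPdist_le => e e0; rewrite near_withinE.
have : \forall y \near x, `|x - y| < e * (1 - r) ^+ 2.
  by exists (e * (1 - r) ^+ 2) => //=; rewrite mulr_gt0.
apply: filterS => y xye; rewrite /= in_itv /= => /andP[y0 yr].
have : `|x - y| / (1 - r) ^+ 2 <= e by rewrite ler_pdivrMr// ltW.
apply: le_trans; have [xy|yx] := leP x y.
  by rewrite [`|x - y|]distrC (ger0_norm (_ : 0 <= y - x)) ?subr_ge0// boltz_sum_lipschitz.
by rewrite (ger0_norm (_ : 0 <= x - y)) ?subr_ge0 ?(ltW yx)// distrC boltz_sum_lipschitz// ltW.
Qed.

(** [boltz_sum s] is at least [expR (beta * energy_inf s) * (z / (1 - z))], so the
    product exceeds [1] for [z] close to [1], and it vanishes for [z = 0]. *)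
Lemma exists_pressure : exists z, 0 < z < 1 /\
  boltz_sum coef beta z false * boltz_sum coef beta z true = 1.
Proof.
pose eps := expR (beta * (energy_inf coef false + energy_inf coef true) / 2).
have eps0 : 0 < eps by exact: expR_gt0.
(* The point where [r / (1 - r) = eps^-1]. *)
pose r := (1 + eps)^-1.
have r0 : 0 < r by rewrite invr_gt0 addr_gt0.
have r1 : r < 1 by rewrite invf_lt1 ?addr_gt0// ltrDl.
have r01 : 0 < r < 1 by rewrite r0.
pose G x := boltz_sum coef beta x false * boltz_sum coef beta x true.
have Gr : 1 <= G r.
  have low s : expR (beta * energy_inf coef s) / eps <= boltz_sum coef beta r s.
    have := tail_boltz_ge coef_lt0 coef_sum beta_gt0 r01 s 0.
    rewrite expr0 mulr1 (_ : r / (1 - r) = eps^-1)//.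
    by rewrite /r; field; rewrite !gt_eqF//= ?addr_gt0//; lra.
  have := ler_pM (ltW (divr_gt0 (expR_gt0 _) eps0)) (ltW (divr_gt0 (expR_gt0 _) eps0))
    (low false) (low true).
  apply: le_trans; rewrite mulrACA -expRD -invfM /eps -expRD.
  by rewrite -mulrDr -splitr divff// gt_eqF// expR_gt0.
have G0 : G 0 = 0 by rewrite /G boltz_sum_at0 mul0r.
have cG : {within `[0, r], continuous G}.
  by move=> x; apply: cvgM; exact: boltz_sum_continuous.
have [|z] := IVT (ltW r0) cG (v := 1).
  by rewrite G0 ge_min ler01 /= le_max Gr orbT.
rewrite in_itv /= => /andP[z0 zr] Gz; exists z; split=> //.
rewrite (le_lt_trans zr r1) andbT lt_neqAle z0 andbT.
by apply/eqP => ez; move: Gz; rewrite -ez G0 => /esym/eqP; rewrite oner_eq0.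
Qed.

End pressure_equation.

(** * Exponential rates as the parameter tends to infinity *)

Section rates.
Context {R : realType}.
Implicit Types (phi psi : R -> R) (r e : R).

Definition rate_le phi r := forall e, 0 < e ->
  \forall b \near +oo, phi b <= expR (b * (r + e)).

(** [phi] is [expR (b * (r + o(1)))]; the lower bound is put on the inverse so
    that both halves follow the same rules. *)
Definition rate phi r := rate_le phi r /\ rate_le (fun b => (phi b)^-1) (- r).

Lemma near_pinfty_gt (A : R) : \forall b \near +oo, A < b.
Proof. by apply: nbhs_pinfty_gt; exact: num_real. Qed.

Lemma rate_le_near phi psi r : (\forall b \near +oo, phi b <= psi b) ->
  rate_le psi r -> rate_le phi r.
Proof.
move=> pp rp e e0; apply: filterS2 pp (rp e e0) => b; exact: le_trans.
Qed.

Lemma rate_le_weaken phi r s : r <= s -> rate_le phi r -> rate_le phi s.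
Proof.
move=> rs rp e e0; apply: filterS2 (near_pinfty_gt 0) (rp e e0) => b b0.
move=> /le_trans; apply; rewrite ler_expR ler_wpM2l ?(ltW b0)//; lra.
Qed.

Lemma rate_le_eps phi r : (forall e, 0 < e -> rate_le phi (r + e)) -> rate_le phi r.
Proof.
move=> h e e0; have e20 : 0 < e / 2 by rewrite divr_gt0.
by have := h _ e20 _ e20; rewrite -addrA -splitr.
Qed.

Lemma rate_le_cst (K : R) : rate_le (fun=> K) 0.
Proof.
move=> e e0; apply: filterS2 (near_pinfty_gt 0) (near_pinfty_gt (K / e)) => b b0 be.
rewrite add0r; apply: le_trans (_ : _ <= b * e) _; first by rewrite -ler_pdivrMr// ltW.
by apply: le_trans (expR_ge1Dx _); rewrite lerDr.
Qed.

Lemma rate_leM phi psi r s : (\forall b \near +oo, 0 <= phi b) ->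
  (\forall b \near +oo, 0 <= psi b) ->
  rate_le phi r -> rate_le psi s -> rate_le (fun b => phi b * psi b) (r + s).
Proof.
move=> phi0 psi0 rp rq e e0; have e20 : 0 < e / 2 by rewrite divr_gt0.
near=> b; have -> : b * (r + s + e) = b * (r + e / 2) + b * (s + e / 2) by field.
rewrite expRD ler_pM//; [near: b; exact: phi0|near: b; exact: psi0| |].
- by near: b; exact: rp.
- by near: b; exact: rq.
Unshelve. all: by end_near. Qed.

Lemma rate_leD phi psi r : rate_le phi r -> rate_le psi r ->
  rate_le (fun b => phi b + psi b) r.
Proof.
move=> rp rq e e0; have e20 : 0 < e / 2 by rewrite divr_gt0.
near=> b; have -> : b * (r + e) = b * (r + e / 2) + b * (0 + e / 2) by field.
rewrite expRD.
have h2 : 2 <= expR (b * (0 + e / 2)) by near: b; exact: (@rate_le_cst 2).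
have h0 := expR_ge0 (b * (r + e / 2)).
have hp : phi b <= expR (b * (r + e / 2)) by near: b; exact: rp.
have hq : psi b <= expR (b * (r + e / 2)) by near: b; exact: rq.
have := ler_wpM2l h0 h2; lra.
Unshelve. all: by end_near. Qed.

Lemma rate_le_exp r : rate_le (fun b => expR (b * r)) r.
Proof.
move=> e e0; apply: filterS (near_pinfty_gt 0) => b b0.
by rewrite ler_expR ler_wpM2l ?(ltW b0)// lerDl ltW.
Qed.

Lemma rate_exp r : rate (fun b => expR (b * r)) r.
Proof.
split; first exact: rate_le_exp.
apply: rate_le_near (rate_le_exp (- r)).
by near=> b; rewrite mulrN expRN.
Unshelve. all: by end_near. Qed.

Lemma rateV phi r : rate phi r -> rate (fun b => (phi b)^-1) (- r).
Proof.
case=> h1 h2; split => //; rewrite opprK.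
by under eq_fun do rewrite invrK.
Qed.

Definition near_pos phi := \forall b \near +oo, 0 < phi b.

Lemma near_pos_ge0 phi : near_pos phi -> \forall b \near +oo, 0 <= phi b.
Proof. by apply: filterS => b /ltW. Qed.

Lemma near_posV phi : near_pos phi -> near_pos (fun b => (phi b)^-1).
Proof. by apply: filterS => b; rewrite invr_gt0. Qed.

Lemma near_posM phi psi : near_pos phi -> near_pos psi ->
  near_pos (fun b => phi b * psi b).
Proof. by move=> p q; apply: filterS2 p q => b; exact: mulr_gt0. Qed.

Lemma rateM phi psi r s : near_pos phi -> near_pos psi ->
  rate phi r -> rate psi s -> rate (fun b => phi b * psi b) (r + s).
Proof.
move=> p q [r1 r2] [s1 s2]; split.
  by apply: rate_leM => //; exact: near_pos_ge0.
rewrite opprD; under eq_fun do rewrite invfM.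
by apply: rate_leM => //; exact/near_pos_ge0/near_posV.
Qed.

Lemma rateD phi psi r : near_pos phi -> near_pos psi ->
  rate phi r -> rate psi r -> rate (fun b => phi b + psi b) r.
Proof.
move=> p q [r1 r2] [s1 s2]; split; first exact: rate_leD.
apply: rate_le_near r2; apply: filterS2 p q => b p0 q0.
by rewrite lef_pV2 ?posrE ?addr_gt0// lerDl ltW.
Qed.

Lemma rate_lnP phi r : near_pos phi -> rate phi r ->
  b^-1 * ln (phi b) @[b --> +oo] --> r.
Proof.
move=> p [r1 r2]; apply/cvgrPdist_le => e e0; near=> b.
have b0 : 0 < b by near: b; exact: near_pinfty_gt.
have p0 : 0 < phi b by near: b; exact: p.
have h1 : phi b <= expR (b * (r + e)) by near: b; exact: r1.
have h2 : (phi b)^-1 <= expR (b * (- r + e)) by near: b; exact: r2.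
have l1 : ln (phi b) <= b * (r + e).
  by rewrite -[leRHS]expRK ler_ln ?posrE ?expR_gt0.
have l2 : - ln (phi b) <= b * (- r + e).
  by rewrite -lnV ?posrE// -[leRHS]expRK ler_ln ?posrE ?expR_gt0 ?invr_gt0.
rewrite ler_norml; apply/andP; split.
  by rewrite lerBrDl -lerBrDr opprK mulrC ler_pdivrMr// mulrC.
rewrite lerBlDr -lerBlDl mulrC ler_pdivlMr//; lra.
Unshelve. all: by end_near. Qed.

End rates.

Section block_rates.
Context {R : realType}.
Variable coef : bool -> nat -> R.
Hypothesis coef_lt0 : forall s n, coef s n < 0.
Hypothesis coef_sum : forall s, cvgn (series (coef s)).

(** [kappa s] will be the rate of [boltz_sum s] and [rho] that of [(1 - z)^-1]:
    they solve [kappa s = energy_inf s + rho], which balances the long blocks, and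
    [kappa false + kappa true = 0], which is the pressure equation. *)
Definition kappa s : R := (energy_inf coef s - energy_inf coef (~~ s)) / 2.

Definition rho : R := - (energy_inf coef false + energy_inf coef true) / 2.

Hypothesis coef_kappa : forall s, coef s 0 <= kappa s.

Lemma kappaN s : kappa (~~ s) = - kappa s.
Proof. by rewrite /kappa negbK -mulNr opprB. Qed.

Lemma kappaE s : kappa s = energy_inf coef s + rho.
Proof. by rewrite /kappa /rho; case: s => /=; field. Qed.

Lemma rho_gt0 : 0 < rho.
Proof.
rewrite /rho divr_gt0// oppr_gt0 addrC.
have := energy_inf_lt0 coef_lt0 coef_sum false.
have := energy_inf_lt0 coef_lt0 coef_sum true; lra.
Qed.

Variable z : R -> R.
Hypothesis z01 : forall b : R, 0 < b -> 0 < z b < 1.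
Hypothesis z_eq : forall b : R, 0 < b ->
  boltz_sum coef b (z b) false * boltz_sum coef b (z b) true = 1.

Let F s b := boltz_sum coef b (z b) s.

(** The mean length of a geometric block of parameter [z b]. *)
Let ell b := (1 - z b)^-1.

Lemma near_pos_of phi : (forall b, 0 < b -> 0 < phi b) -> near_pos (phi : R -> R).
Proof. by move=> h; apply: filterS (near_pinfty_gt 0) => b; exact: h. Qed.

Let F_gt0 s b : 0 < b -> 0 < F s b.
Proof. by move=> b0; apply: boltz_sum_gt0 => //; exact: z01. Qed.

Let ell_gt0 b : 0 < b -> 0 < ell b.
Proof. by move=> /z01 /andP[_ z1]; rewrite invr_gt0 subr_gt0. Qed.

Let z_gt0 b : 0 < b -> 0 < z b.
Proof. by move=> /z01 /andP[]. Qed.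

Lemma F_inv s b : 0 < b -> (F s b)^-1 = F (~~ s) b.
Proof.
move=> b0; have e : F s b * F (~~ s) b = 1.
  by case: s; [rewrite mulrC|]; exact: z_eq.
have Fn0 : F s b != 0 by rewrite gt_eqF// F_gt0.
by apply: (mulfI Fn0); rewrite mulfV// e.
Qed.

(** The long blocks alone give [boltz_sum s] at least the value
    [expR (b * energy_inf s) * (z / (1 - z))], while the product over [s] is [1]. *)
Lemma rate_le_ell : rate_le ell rho.
Proof.
have h : rate_le (fun b => 1 + expR (b * rho)) rho.
  apply: rate_leD (rate_le_exp rho).
  by apply: rate_le_weaken (rate_le_cst 1); exact/ltW/rho_gt0.
apply: rate_le_near h; apply: filterS (near_pinfty_gt 0) => b b0.
have zb := z01 b0; have /andP[z0 z1] := zb.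
have low s : expR (b * energy_inf coef s) * (z b / (1 - z b)) <= F s b.
  by have := tail_boltz_ge coef_lt0 coef_sum b0 zb s 0; rewrite expr0 mulr1.
pose y := z b / (1 - z b).
have y0 : 0 < y by rewrite divr_gt0 ?subr_gt0.
have ellE : ell b = 1 + y by rewrite /ell /y; field; rewrite gt_eqF// subr_gt0.
rewrite ellE lerD2l.
have : (expR (b * - rho) * y) ^+ 2 <= 1.
  rewrite -(z_eq b0) exprMn -expRM_natl.
  have -> : 2 * (b * - rho) = b * energy_inf coef false + b * energy_inf coef true.
    by rewrite /rho; field.
  rewrite expRD expr2 mulrACA.
  by apply: ler_pM (low _) (low _); apply: mulr_ge0; rewrite ?expR_ge0// ltW.
have Q0 : 0 <= expR (b * - rho) * y by apply: mulr_ge0; rewrite ?expR_ge0// ltW.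
rewrite expr_le1//.
rewrite mulrN expRN mulrC ler_pdivrMr ?expR_gt0//.
by rewrite mul1r.
Qed.

(** Beyond some length the energies of the blocks are within [e] of their limit;
    the finitely many shorter blocks are dominated by a geometric series of ratio
    [1 / 2]. *)
Lemma boltz_dominated s e : 0 < e -> exists K, 0 < K /\ forall b r, 0 < b ->
  boltz coef b (z b) s r <= K * expR (b * coef s 0) * 2^-1 ^+ r +
    expR (b * (energy_inf coef s + e)) * z b ^+ r.
Proof.
move=> e0.
have [N _ NP] : \forall n \near \oo, energy coef s n <= energy_inf coef s + e.
  have ce : energy coef s n @[n --> \oo] --> energy_inf coef s by exact: cvg_energy.
  have [N _ NP] := cvgr_dist_le _ _ ce _ e0.
  exists N => // n /NP; rewrite ler_norml => /andP[+ _]; lra.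
exists (2 ^+ N); split; first exact: exprn_gt0.
move=> b r b0; have /andP[z0 z1] := z01 b0.
have E0 := expR_gt0 (b * coef s 0).
have E1 := expR_gt0 (b * (energy_inf coef s + e)).
have zr : 0 <= z b ^+ r by rewrite exprn_ge0// ltW.
have zr1 : z b ^+ r.+1 <= z b ^+ r by rewrite exprS ler_piMl// ltW.
have [Nr|rN] := leqP N r.+1.
  apply: (@le_trans _ _ (expR (b * (energy_inf coef s + e)) * z b ^+ r)).
    rewrite /boltz ler_pM ?expR_ge0 ?exprn_ge0 ?(ltW z0)// ler_expR ler_wpM2l ?(ltW b0)//.
    exact: NP.
  by rewrite lerDr !mulr_ge0// ?exprn_ge0 ?invr_ge0 ?ltW// ltW.
apply: (@le_trans _ _ (expR (b * coef s 0))).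
  rewrite /boltz -[leRHS]mulr1 ler_pM ?expR_ge0 ?exprn_ge0 ?(ltW z0)//.
    rewrite ler_expR ler_wpM2l ?(ltW b0)//.
    by have := energy_le coef_lt0 s (ltn0Sn r); rewrite energy1.
  by rewrite exprn_ile1// ltW.
rewrite -[leLHS]addr0 lerD// ?mulr_ge0 ?(ltW E1)//.
rewrite mulrAC ler_peMl ?(ltW E0)// exprVn ler_pdivlMr ?exprn_gt0// mul1r.
by rewrite ler_weXn2l ?ler1n// ltnW// (leq_trans _ rN).
Qed.

Lemma tails_dominated s e : 0 < e -> exists K, 0 < K /\ forall b, 0 < b ->
  F s b <= K * expR (b * coef s 0) + expR (b * (energy_inf coef s + e)) * ell b /\
  tail (tail (boltz coef b (z b) s)) 0 <=
    K * expR (b * coef s 0) + expR (b * (energy_inf coef s + e)) * ell b ^+ 2.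
Proof.
move=> e0; have [K [K0 KP]] := boltz_dominated s e0.
exists (4 * K); split; first by rewrite mulr_gt0.
move=> b b0; have zb := z01 b0; have /andP[z0 z1] := zb.
set M := expR (b * coef s 0); set Q := expR (b * (_ + e)).
have M0 : 0 < M := expR_gt0 _.
have half01 : 0 <= (2^-1 : R) < 1 by apply/andP; split; lra.
have zr01 : 0 <= z b < 1 by rewrite ltW.
have ch (A : R) : cvgn (series (fun r => A * 2^-1 ^+ r)).
  exact/cvg_seriesZl/cvg_geometric01.
have cz (A : R) : cvgn (series (fun r => A * z b ^+ r)).
  exact/cvg_seriesZl/cvg_geometric01.
have cb : cvgn (series (boltz coef b (z b) s)) by exact: cvg_boltz.
have cb2 : cvgn (series (tail (boltz coef b (z b) s))) by exact: cvg_tail_boltz.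
have tailE (A B : R) q : tail (fun r => A * 2^-1 ^+ r + B * z b ^+ r) q =
    2 * A * 2^-1 ^+ q + B * ell b * z b ^+ q.
  rewrite tailD// !tailZl ?tail_geometric//; try exact: cvg_geometric01.
  by rewrite /ell; field; rewrite gt_eqF// subr_gt0.
have t1 q : tail (boltz coef b (z b) s) q <=
    2 * (K * M) * 2^-1 ^+ q + Q * ell b * z b ^+ q.
  rewrite -tailE; apply: le_tail => // [|r _]; last exact: KP.
  exact: cvg_seriesD.
split.
  apply: le_trans (t1 0%N) _; rewrite !expr0 !mulr1 lerD2r.
  have := mulr_gt0 K0 M0; lra.
apply: (@le_trans _ _ (2 * (2 * (K * M)) * 2^-1 ^+ 0 + Q * ell b * ell b * z b ^+ 0)).
  by rewrite -tailE; apply: le_tail => //; exact: cvg_seriesD.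
by rewrite le_eqVlt; apply/orP; left; apply/eqP; ring.
Qed.

Let near_F s : near_pos (F s). Proof. by apply: near_pos_of => b; exact: F_gt0. Qed.

Let near_ell : near_pos ell. Proof. by apply: near_pos_of => b; exact: ell_gt0. Qed.

Let near_z : near_pos z. Proof. by apply: near_pos_of => b; exact: z_gt0. Qed.

Let near_exp r : near_pos (fun b : R => expR (b * r)).
Proof. by apply: near_pos_of => b _; exact: expR_gt0. Qed.

Lemma rate_le_scale (K r : R) : 0 < K -> rate_le (fun b => K * expR (b * r)) r.
Proof.
move=> K0.
have := @rate_leM R (fun=> K) (fun b => expR (b * r)) 0 r.
rewrite add0r; apply.
- by apply: filterS (near_pinfty_gt 0) => b _; exact: ltW.
- exact: near_pos_ge0 (near_exp r).
- exact: rate_le_cst.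
- exact: rate_le_exp.
Qed.

Lemma rate_boltz_sum_le s : rate_le (F s) (kappa s).
Proof.
apply: rate_le_eps => e e0; have [K [K0 KP]] := tails_dominated s e0.
apply: (@rate_le_near _ _ (fun b => K * expR (b * coef s 0) +
    expR (b * (energy_inf coef s + e)) * ell b)).
  by apply: filterS (near_pinfty_gt 0) => b /KP[].
apply: rate_leD.
  apply: rate_le_weaken (rate_le_scale (coef s 0) K0).
  by have := coef_kappa s; lra.
rewrite kappaE addrAC; apply: rate_leM; [exact/near_pos_ge0/near_exp|
  exact: near_pos_ge0 near_ell|exact: rate_le_exp|exact: rate_le_ell].
Qed.

Lemma rate_boltz_sum s : rate (F s) (kappa s).
Proof.
split; first exact: rate_boltz_sum_le.
rewrite -kappaN; apply: rate_le_near (rate_boltz_sum_le (~~ s)).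
by apply: filterS (near_pinfty_gt 0) => b b0; rewrite F_inv.
Qed.

(** For one symbol [s] at least the short blocks are negligible in [F s], since
    [coef false 0 + coef true 0 < 0 = kappa false + kappa true]; the long blocks
    of this symbol determine [ell]. *)
Lemma rate_ell : rate ell rho.
Proof.
split; first exact: rate_le_ell.
have [s sk] : exists s, coef s 0 < kappa s.
  have [h|h] := ltP (coef false 0) (kappa false); first by exists false.
  exists true; have := kappaN false; have := coef_lt0 false 0.
  by have := coef_lt0 true 0; rewrite /=; lra.
apply: rate_le_eps => e e0.
(* Small enough for the short blocks to stay below [F s] by a factor
   of order [expR (- b * del)]. *)
pose del := Num.min (e / 2) ((kappa s - coef s 0) / 2).
have del0 : 0 < del by rewrite lt_min !divr_gt0// subr_gt0.
have dele : del <= e / 2 by rewrite ge_min lexx.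
have delk : del <= (kappa s - coef s 0) / 2 by rewrite ge_min lexx orbT.
have e20 : 0 < e / 2 by rewrite divr_gt0.
have [K [K0 KP]] := tails_dominated s e20.
apply: (@rate_le_near _ _ (fun b => 2 * expR (b * (- rho + e / 2 + del)))); last first.
  apply: rate_le_weaken (rate_le_scale _ _) => //; lra.
near=> b.
have b0 : 0 < b by near: b; exact: near_pinfty_gt.
have Fb : (F s b)^-1 <= expR (b * (- kappa s + del)).
  by near: b; exact: (rate_boltz_sum s).2.
have Kb : 2 * K <= expR (b * (0 + del)) by near: b; exact: rate_le_cst.
have [up _] := KP b b0; have F0 := F_gt0 s b0; have l0 := ell_gt0 b0.
have lo : expR (b * (kappa s - del)) <= F s b.
  rewrite -(invrK (F s b)) -[expR _]invrK lef_pV2 ?posrE ?invr_gt0 ?expR_gt0//.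
  by rewrite -expRN (_ : - (b * _) = b * (- kappa s + del))//; ring.
have short : K * expR (b * coef s 0) <= expR (b * (kappa s - del)) / 2.
  rewrite ler_pdivlMr// mulrAC.
  apply: (@le_trans _ _ (expR (b * (0 + del)) * expR (b * coef s 0))).
    by rewrite ler_wpM2r ?expR_ge0// mulrC.
  rewrite -expRD ler_expR -mulrDr ler_wpM2l ?(ltW b0)//; lra.
have long : expR (b * (kappa s - del)) / 2 <=
    expR (b * (energy_inf coef s + e / 2)) * ell b by lra.
rewrite -[leLHS]mul1r ler_pdivrMr//.
have A0 := expR_gt0 (b * (kappa s - del)).
rewrite -(ler_pM2l A0).
have QA : expR (b * (kappa s - del)) * expR (b * (- rho + e / 2 + del)) =
    expR (b * (energy_inf coef s + e / 2)).
  by rewrite -expRD; congr expR; rewrite kappaE; ring.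
by move: long; rewrite -QA; lra.
Unshelve. all: by end_near. Qed.

Lemma rate_z : rate z 0.
Proof.
split.
  apply: rate_le_near (rate_le_cst 1).
  by apply: filterS (near_pinfty_gt 0) => b /z01 /andP[_ /ltW].
rewrite oppr0; apply: rate_le_near (rate_le_cst 2).
have r20 : 0 < rho / 2 by rewrite divr_gt0// rho_gt0.
near=> b.
have b0 : 0 < b by near: b; exact: near_pinfty_gt.
have lb : (ell b)^-1 <= expR (b * (- rho + rho / 2)) by near: b; exact: rate_ell.2.
have h2 : 2 <= expR (b * (0 + rho / 2)) by near: b; exact: rate_le_cst.
have z0 := z_gt0 b0.
have lb2 : (ell b)^-1 <= 2^-1.
  apply: le_trans lb _; rewrite (_ : b * _ = - (b * (0 + rho / 2))); last by field.
  by rewrite expRN lef_pV2 ?posrE ?expR_gt0.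
rewrite -[leRHS]invrK lef_pV2 ?posrE ?invr_gt0//.
by move: lb2; rewrite /ell invrK; lra.
Unshelve. all: by end_near. Qed.

Lemma rate_zX n : rate (fun b => z b ^+ n) 0.
Proof.
elim: n => [|n IH].
  split; [|under eq_fun do rewrite expr0 invr1; rewrite oppr0]; exact: rate_le_cst.
under eq_fun do rewrite exprS; rewrite -[0]addr0; apply: rateM => //.
  by apply: near_pos_of => b b0; rewrite exprn_gt0// z_gt0.
exact: rate_z.
Qed.

Let near_zX n : near_pos (fun b => z b ^+ n).
Proof. by apply: near_pos_of => b b0; rewrite exprn_gt0// z_gt0. Qed.

Lemma rate_block_prob s r :
  rate (fun b => block_prob coef b (z b) s r) (energy coef s r.+1 - kappa s).
Proof.
rewrite -[energy coef s r.+1]addr0; apply: rateM; last exact/rateV/rate_boltz_sum.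
- by apply: near_posM; [exact: near_exp|exact: near_zX].
- exact/near_posV/near_F.
- by apply: rateM; [exact: near_exp|exact: near_zX|exact: rate_exp|exact: rate_zX].
Qed.

Lemma rate_block_tail s r : rate (fun b => block_tail coef b (z b) s r) 0.
Proof.
split.
  apply: rate_le_near (rate_le_cst 1); apply: filterS (near_pinfty_gt 0) => b b0.
  have zb := z01 b0; elim: r => [|r IH]; first by rewrite block_tail0.
  apply: le_trans IH; rewrite [leRHS]block_tailE lerDr ltW//.
  exact: block_prob_gt0.
pose low b := expR (b * energy_inf coef s) * (ell b * z b ^+ r.+1).
have plow : near_pos low.
  by apply: near_posM; [exact: near_exp|apply: near_posM; [exact: near_ell|exact: near_zX]].
have rlow : rate low (energy_inf coef s + (rho + 0)).
  apply: rateM; [exact: near_exp|by apply: near_posM; [exact: near_ell|exact: near_zX]|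
    exact: rate_exp|].
  by apply: rateM; [exact: near_ell|exact: near_zX|exact: rate_ell|exact: rate_zX].
have : rate (fun b => F s b * (low b)^-1) 0.
  rewrite (_ : 0 = kappa s - (energy_inf coef s + (rho + 0))); last by rewrite kappaE; ring.
  by apply: rateM; [exact: near_F|exact: near_posV|exact: rate_boltz_sum|exact: rateV].
case=> + _; rewrite oppr0; apply: rate_le_near; apply: filterS (near_pinfty_gt 0) => b b0.
have zb := z01 b0; have /andP[z0 z1] := zb.
rewrite /block_tail invf_div ler_wpM2l ?(ltW (F_gt0 s b0))//.
have := tail_boltz_ge coef_lt0 coef_sum b0 zb s r.
rewrite lef_pV2 ?posrE ?tail_boltz_gt0//; last first.
  by rewrite /low !mulr_gt0 ?expR_gt0 ?ell_gt0 ?exprn_gt0.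
by apply: le_trans; rewrite /low /ell exprS le_eqVlt; apply/orP; left; apply/eqP; ring.
Qed.

Lemma rate_block_tail2 s r : rate (fun b => block_tail2 coef b (z b) s r) rho.
Proof.
split.
  apply: rate_le_eps => e e0; have [K [K0 KP]] := tails_dominated s e0.
  apply: (@rate_le_near _ _ (fun b => (K * expR (b * coef s 0) +
      expR (b * (energy_inf coef s + e)) * ell b ^+ 2) * (F s b)^-1)).
    apply: filterS (near_pinfty_gt 0) => b b0; have zb := z01 b0.
    apply: (@le_trans _ _ (block_tail2 coef b (z b) s 0)).
      elim: r => // r IH; apply: le_trans IH.
      by rewrite [leRHS]block_tail2E lerDr ltW// block_tail_gt0.
    by rewrite ler_wpM2r ?invr_ge0 ?(ltW (F_gt0 s b0))//; case: (KP b b0).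
  rewrite (_ : rho + e = (kappa s + rho + e) - kappa s); last by ring.
  apply: rate_leM; last exact: (rateV (rate_boltz_sum s)).1.
  - apply: filterS (near_pinfty_gt 0) => b b0.
    by rewrite addr_ge0 ?mulr_ge0 ?expR_ge0 ?exprn_ge0 ?(ltW K0) ?(ltW (ell_gt0 b0)).
  - exact/near_pos_ge0/near_posV/near_F.
  apply: rate_leD.
    apply: rate_le_weaken (rate_le_scale _ K0).
    have := coef_kappa s; have := rho_gt0; lra.
  rewrite (_ : kappa s + rho + e = energy_inf coef s + e + (rho + rho)); last first.
    by rewrite kappaE; ring.
  under eq_fun do rewrite expr2.
  apply: rate_leM; [exact/near_pos_ge0/near_exp| |exact: rate_le_exp|].
    by apply/near_pos_ge0/near_posM; exact: near_ell.
  by apply: rate_leM; [exact: near_pos_ge0 near_ell|exact: near_pos_ge0 near_ell|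
    exact: rate_le_ell|exact: rate_le_ell].
pose low b := expR (b * energy_inf coef s) * (ell b * ell b * z b ^+ r.+1).
have pll : near_pos (fun b => ell b * ell b) by apply: near_posM; exact: near_ell.
have plow : near_pos low.
  by apply: near_posM; [exact: near_exp|apply: near_posM; [exact: pll|exact: near_zX]].
have rlow : rate low (energy_inf coef s + (rho + rho + 0)).
  apply: rateM; [exact: near_exp|by apply: near_posM; [exact: pll|exact: near_zX]|
    exact: rate_exp|].
  apply: rateM; [exact: pll|exact: near_zX| |exact: rate_zX].
  by apply: rateM; [exact: near_ell|exact: near_ell|exact: rate_ell|exact: rate_ell].
have : rate (fun b => F s b * (low b)^-1) (- rho).
  rewrite (_ : - rho = kappa s - (energy_inf coef s + (rho + rho + 0))); last by rewrite kappaE; ring.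
  by apply: rateM; [exact: near_F|exact: near_posV|exact: rate_boltz_sum|exact: rateV].
case=> + _; apply: rate_le_near; apply: filterS (near_pinfty_gt 0) => b b0.
have zb := z01 b0; have /andP[z0 z1] := zb.
have t20 : 0 < tail (tail (boltz coef b (z b) s)) r.
  have Fs : 0 < boltz_sum coef b (z b) s by exact: F_gt0.
  by have := block_tail2_gt0 coef_lt0 coef_sum b0 zb s r; rewrite pmulr_lgt0 ?invr_gt0.
rewrite /block_tail2 invf_div ler_wpM2l ?(ltW (F_gt0 s b0))//.
have := tail2_boltz_ge coef_lt0 coef_sum b0 zb s r.
rewrite lef_pV2 ?posrE//; last first.
  by rewrite /low !mulr_gt0 ?expR_gt0 ?ell_gt0 ?exprn_gt0.
by apply: le_trans; rewrite /low /ell exprS -exprVn le_eqVlt; apply/orP; left; apply/eqP; ring.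
Qed.

End block_rates.

(** * The deviation function *)

Lemma const_point_cons s : const_point s = concat [:: s] (const_point s).
Proof. exact/esym/(concat_nseq_const 1). Qed.

Lemma cat_nseq_cons r (s : bool) w : nseq r.+1 s ++ s :: w = nseq r.+2 s ++ w.
Proof. by rewrite -cat_rcons -cats1 (_ : [:: s] = nseq 1 s)// -nseqD addn1. Qed.

Lemma run_cases (x : shift_space) :
  (exists s y, x = concat [:: s; s] y) \/
  exists s, (exists r y, x = concat (~~ s :: rcons (nseq r.+1 s) (~~ s)) y) \/
    x = concat [:: ~~ s] (const_point s).
Proof.
have xE : x = concat [:: x 0%N; x 1%N] (iter 2 shift_map x) by rewrite -[LHS](concat_pref 2).
have [x01|x01] := eqVneq (x 0%N) (x 1%N).
  by left; exists (x 0%N), (iter 2 shift_map x); rewrite {1}xE -x01.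
right; exists (x 1%N); have x0 : x 0%N = ~~ x 1%N by move: x01; case: (x 0%N); case: (x 1%N).
rewrite xE x0 -cat1s concat_cat.
have [->|[k [z ->]]] := const_or_run (x 1%N) (iter 2 shift_map x).
  by right; rewrite -const_point_cons.
by left; exists k, z; rewrite -!concat_cat.
Qed.

Section deviation.
Context {R : realType}.
Variables (cost : bool -> nat -> R) (rho gap : R).

(** The asymptotic costs of [inner], [outer] and [weight]: a complete block costs
    [cost], the start of the second block costs [rho]. *)
Fixpoint dev_inner (s : bool) (r : nat) (w : seq bool) : R :=
  if w is x :: w' then
    if x == s then dev_inner s r.+1 w' else cost s r + dev_inner x 0 w'
  else 0.

Fixpoint dev_outer (s : bool) (w : seq bool) : R :=
  if w is x :: w' then
    if x == s then dev_outer s w' else rho + dev_inner x 0 w'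
  else 0.

Definition dev (w : seq bool) : R := if w is x :: w' then dev_outer x w' else 0.

Hypothesis cost_ge0 : forall s r, 0 <= cost s r.
Hypothesis rho_ge0 : 0 <= rho.
Hypothesis gap_gt0 : 0 < gap.
Hypothesis cost_gap : forall s r t, gap <= cost s r + cost (~~ s) t.

Lemma dev_inner_ge0 s r w : 0 <= dev_inner s r w.
Proof.
by elim: w s r => //= x w IH s r; case: ifP => _ //; exact: addr_ge0.
Qed.

Variable rp : shift_space -> R.
Hypothesis rp_same : forall s y, rp (concat [:: s; s] y) = 0.
Hypothesis rp_run : forall s r y,
  rp (concat (~~ s :: rcons (nseq r.+1 s) (~~ s)) y) = cost s r.
Hypothesis rp_const : forall s, rp (concat [:: ~~ s] (const_point s)) = rho.

Definition total (x : shift_space) : \bar R :=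
  limn (fun n => (birkhoff_sum rp n x)%:E).

Lemma rp_ge0 x : 0 <= rp x.
Proof.
by have [[s [y ->]]|[s [[r [y ->]]|->]]] := run_cases x; rewrite ?rp_same ?rp_run ?rp_const.
Qed.

Lemma birkhoff_sum_ndecr x : {homo (birkhoff_sum rp)^~ x : m n / (m <= n)%N >-> m <= n}.
Proof.
apply/nondecreasing_seqP => n; rewrite /birkhoff_sum big_ord_recr /= lerDl.
exact: rp_ge0.
Qed.

Lemma is_cvg_total x : cvgn (fun n => (birkhoff_sum rp n x)%:E).
Proof.
apply: ereal_nondecreasing_is_cvgn => m n mn; rewrite lee_fin.
exact: birkhoff_sum_ndecr.
Qed.

Lemma totalE x : total x = ereal_sup (range (fun n => (birkhoff_sum rp n x)%:E)).
Proof.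
apply: cvg_lim => //; apply: ereal_nondecreasing_cvgn => m n mn.
by rewrite lee_fin; exact: birkhoff_sum_ndecr.
Qed.

Lemma total_ge n x : ((birkhoff_sum rp n x)%:E <= total x)%E.
Proof. by rewrite totalE; apply: ereal_sup_ubound; exists n. Qed.

Lemma total_ge0 x : (0 <= total x)%E.
Proof. by have := total_ge 0 x; rewrite /birkhoff_sum big_ord0. Qed.

Lemma total_shift x : total x = ((rp x)%:E + total (shift_map x))%E.
Proof.
apply: cvg_lim => //; rewrite -cvg_shiftS /=.
under eq_fun do rewrite birkhoff_sumS EFinD.
apply: cvgeD; [|exact: cvg_cst|exact: is_cvg_total].
by rewrite fin_num_adde_defr.
Qed.

Lemma total_const s : total (const_point s) = 0%E.
Proof.
apply: cvg_lim => //; rewrite (_ : (fun n => _) = fun=> 0%E); first exact: cvg_cst.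
apply/funext => n; congr (_%:E); rewrite /birkhoff_sum big1// => j _.
have -> : iter j shift_map (const_point s) = const_point s.
  by elim: (j : nat) => //= i ->.
by rewrite const_point_cons [X in concat _ X]const_point_cons -concat_cat rp_same.
Qed.

Lemma total_same s y : total (concat [:: s; s] y) = total (concat [:: s] y).
Proof. by rewrite total_shift rp_same add0e. Qed.

Lemma total_nseq s r y : total (concat (nseq r.+1 s) y) = total (concat [:: s] y).
Proof.
elim: r => // r IH; rewrite -IH -[nseq r.+2 s]/([:: s; s] ++ nseq r s) concat_cat.
by rewrite total_same -concat_cat.
Qed.

Lemma total_run s r y :
  total (concat (~~ s :: nseq r.+1 s) (concat [:: ~~ s] y)) =
  ((cost s r)%:E + total (concat [:: s; ~~ s] y))%E.
Proof.
rewrite -concat_cat cat_cons cats1 total_shift rp_run shift_concat_cons.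
congr (_ + _)%E; rewrite -cats1 concat_cat total_nseq -concat_cat.
by [].
Qed.

Lemma total_run_cons s r y :
  total (concat [:: s, ~~ s & rcons (nseq r (~~ s)) s] y) =
  ((cost (~~ s) r)%:E + total (concat [:: ~~ s; s] y))%E.
Proof. by have := total_run (~~ s) r y; rewrite negbK -concat_cat !cat_cons cats1. Qed.

Lemma total_last s r : total (concat (~~ s :: nseq r.+1 s) (const_point s)) = rho%:E.
Proof.
rewrite -cat1s concat_cat concat_nseq_const total_shift rp_const.
by rewrite shift_concat_cons concat_nil total_const adde0.
Qed.

Lemma total_inner_const s r w :
  total (concat (~~ s :: nseq r.+1 s) (concat w (const_point (last s w)))) =
  (rho + dev_inner s r w)%:E.
Proof.
elim: w s r => [|x w IH] s r /=.
  by rewrite concat_nil total_last addr0.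
case: eqP => [->|/eqP xs].
  rewrite -IH -!concat_cat; congr (total (concat _ _)).
  exact: (congr1 (cons (~~ s)) (cat_nseq_cons r s w)).
have {}xs : x = ~~ s by case: x s xs {IH} => -[].
rewrite -[x :: w]cat1s concat_cat xs total_run -xs addrCA EFinD -IH.
by congr (_ + total _)%E; rewrite -!concat_cat xs negbK.
Qed.

Lemma total_outer_const s r w :
  total (concat (nseq r.+1 s) (concat w (const_point (last s w)))) =
  (dev_outer s w)%:E.
Proof.
elim: w s r => [|x w IH] s r; first by rewrite concat_nil concat_nseq_const total_const.
rewrite /=; case: eqP => [->|/eqP xs].
  rewrite -(IH s r.+1) -!concat_cat; congr (total (concat _ _)).
  exact: cat_nseq_cons.
have {}xs : x = ~~ s by case: x s xs {IH} => -[].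
rewrite total_nseq -(total_inner_const x 0) -!concat_cat xs negbK.
by [].
Qed.

Lemma total_const_tail w : total (concat w (const_point (last false w))) = (dev w)%:E.
Proof.
case: w => [|x w]; first by rewrite concat_nil total_const.
by rewrite -(total_outer_const x 0) -concat_cat.
Qed.

Definition eventually_const (x : shift_space) :=
  exists w s, x = concat w (const_point s).

Lemma eventually_const_concat w x :
  eventually_const x -> eventually_const (concat w x).
Proof. by case=> v [s ->]; exists (w ++ v), s; rewrite concat_cat. Qed.

Lemma eventually_const_concat_inv w x :
  eventually_const (concat w x) -> eventually_const x.
Proof.
elim: w => [|t w IH]; first by rewrite concat_nil.
case=> v [s e]; apply: IH; move: (congr1 shift_map e); rewrite shift_concat_cons => ->.
case: v {e} => [|u v]; last by exists v, s.
by exists [::], s; rewrite !concat_nil.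
Qed.

Lemma not_eventually_const_run s x : ~ eventually_const x ->
  exists k z, x = concat (rcons (nseq k s) (~~ s)) z /\ ~ eventually_const z.
Proof.
move=> nx; have [xs|[k [z xz]]] := const_or_run s x.
  by case: nx; exists [::], s; rewrite concat_nil.
exists k, z; split=> //; apply: contra_not nx => ez.
by rewrite xz; exact: eventually_const_concat.
Qed.

(** Two successive complete blocks cost at least [gap], so a prefix with many
    changes of symbol forces a large value. *)
Lemma total_many_runs m s z : ~ eventually_const z -> exists w z',
  z = concat w z' /\
  forall y, ((m%:R * gap)%:E <= total (concat [:: s, ~~ s & w] y))%E.
Proof.
elim: m s z => [|m IH] s z nz.
  by exists [::], z; rewrite concat_nil; split=> // y; rewrite mul0r total_ge0.
have [k [z1 [zE nz1]]] := not_eventually_const_run (~~ s) nz.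
have [j [z2 [z1E nz2]]] := not_eventually_const_run s nz1.
have [w [z' [z2E wP]]] := IH s z2 nz2.
exists (rcons (nseq k (~~ s)) s ++ rcons (nseq j s) (~~ s) ++ w), z'.
split; first by rewrite zE z1E z2E !concat_cat negbK.
move=> y; set V := rcons (nseq j s) _.
have -> : concat [:: s, ~~ s & rcons (nseq k (~~ s)) s ++ V ++ w] y =
    concat [:: s, ~~ s & rcons (nseq k (~~ s)) s] (concat (V ++ w) y).
  by rewrite -concat_cat.
rewrite total_run_cons.
have -> : concat [:: ~~ s; s] (concat (V ++ w) y) =
    concat [:: ~~ s, s & V] (concat w y) by rewrite -!concat_cat.
have := total_run_cons (~~ s) j (concat w y); rewrite negbK => ->.
have -> : m.+1%:R * gap = gap + m%:R * gap by rewrite -natr1 mulrDl mul1r addrC.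
rewrite addeA -EFinD (EFinD gap); apply: leeD.
  by rewrite lee_fin; have := cost_gap (~~ s) k j; rewrite negbK.
by rewrite -concat_cat; exact: wP.
Qed.

Lemma total_not_eventually_const x (A : R) : ~ eventually_const x ->
  exists n, forall y, cylinder (pref n x) y -> (A%:E <= total y)%E.
Proof.
move=> nx; pose s := x 0%N.
have [k [z [xz nz]]] := not_eventually_const_run s nx.
have [k' xk] : exists k', k = k'.+1.
  case: k xz => [|k'] xz; last by exists k'.
  by move: (congr1 (@^~ 0%N) xz); rewrite /= concat_cons -/s; case: (s).
have [m mA] : exists m : nat, A <= m%:R * gap.
  exists (Num.trunc (`|A| / gap)).+1; apply: le_trans (ler_norm A) _.
  by rewrite -ler_pdivrMr// ltW// truncnS_gt.
have [w [z' [zw wP]]] := total_many_runs m s nz.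
exists (size (rcons (nseq k s) (~~ s) ++ w)) => y.
rewrite {1}xz zw -concat_cat pref_concat => -[y' ->].
apply: (@le_trans _ _ (m%:R * gap)%:E); first by rewrite lee_fin.
rewrite xk -cats1 !concat_cat total_nseq.
by have := wP y'; rewrite -!concat_cat.
Qed.

Lemma total_infinite x : ~ eventually_const x -> total x = +oo%E.
Proof.
move=> nx.
have h (A : R) : (A%:E <= total x)%E.
  by have [n /(_ x (cylinder_pref n x))] := total_not_eventually_const A nx.
case E : (total x) => [r| |] //; last by have := h 0; rewrite E.
by have := h (r + 1); rewrite E lee_fin gerDl ler10.
Qed.

(** After the prefix [w] the point continues with some blocks and ends with an
    infinite one, whose cost is [rho], or its value is infinite. *)
Lemma total_inner_ge s r w y :
  ((rho + dev_inner s r w)%:E <= total (concat (~~ s :: nseq r.+1 s) (concat w y)))%E.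
Proof.
elim: w s r => [|x w IH] s r.
  rewrite addr0 concat_nil; have [[v [t ->]]|ny] := pselect (eventually_const y).
    have -> : concat v (const_point t) =
        concat (rcons v t) (const_point (last s (rcons v t))).
      by rewrite last_rcons -cats1 concat_cat -const_point_cons.
    by rewrite total_inner_const lee_fin lerDl dev_inner_ge0.
  rewrite total_infinite ?leey//; apply: contra_not ny.
  exact: eventually_const_concat_inv.
rewrite /=; case: eqP => [->|/eqP xs].
  apply: le_trans (IH s r.+1) _; rewrite -!concat_cat le_eqVlt; apply/orP; left.
  apply/eqP; congr (total (concat _ _)).
  exact/esym/(congr1 (cons (~~ s)) (cat_nseq_cons r s w)).
have {}xs : x = ~~ s by case: x s xs {IH} => -[].
rewrite -[x :: w]cat1s concat_cat xs total_run -xs addrCA EFinD leeD2l//.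
apply: le_trans (IH x 0%N) _.
by rewrite -!concat_cat xs negbK.
Qed.

Lemma total_outer_ge s r w y :
  ((dev_outer s w)%:E <= total (concat (nseq r.+1 s) (concat w y)))%E.
Proof.
elim: w s r => [|x w IH] s r; first exact: total_ge0.
rewrite /=; case: eqP => [->|/eqP xs].
  apply: le_trans (IH s r.+1) _; rewrite -!concat_cat le_eqVlt; apply/orP; left.
  apply/eqP; congr (total (concat _ _)).
  exact/esym/cat_nseq_cons.
have {}xs : x = ~~ s by case: x s xs {IH} => -[].
rewrite total_nseq; apply: le_trans (total_inner_ge x 0 w y) _.
by rewrite -!concat_cat xs negbK.
Qed.

Lemma total_cylinder_ge w x : cylinder w x -> ((dev w)%:E <= total x)%E.
Proof.
case: w => [|s w]; first by move=> _; exact: total_ge0.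
by case=> y ->; have := total_outer_ge s 0 w y; rewrite -concat_cat.
Qed.

(** The infimum is attained by repeating the last symbol of [w] forever. *)
Lemma ereal_inf_total w : ereal_inf (total @` cylinder w) = (dev w)%:E.
Proof.
apply/eqP; rewrite eq_le; apply/andP; split.
  apply: ereal_inf_lbound; exists (concat w (const_point (last false w))).
    by exists (const_point (last false w)).
  exact: total_const_tail.
by apply: le_ereal_inf_tmp => _ [x wx <-]; exact: total_cylinder_ge.
Qed.

(** At an eventually constant point the value is attained by the cost of a
    prefix, which bounds the deviation function on the cylinder; elsewhere the
    costs of the prefixes are unbounded. *)
Lemma total_lsc : lower_semicontinuous total.
Proof.
move=> x A Ax; have [[w [t xE]]|nx] := pselect (eventually_const x).
  pose n := (size w).+1; exists (cylinder (pref n x)); first exact: cylinder_nbhs.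
  move=> y /total_cylinder_ge; apply: lt_le_trans; move: Ax.
  have wE : x = concat (rcons w t) (const_point (last false (rcons w t))).
    by rewrite xE last_rcons -cats1 concat_cat -const_point_cons.
  have -> : pref n x = rcons w t by rewrite wE /n -(size_rcons w t) pref_concat.
  by rewrite {1}wE total_const_tail.
have [n nP] := total_not_eventually_const (A + 1) nx.
exists (cylinder (pref n x)); first exact: cylinder_nbhs.
by move=> y /nP; apply: lt_le_trans; rewrite lte_fin ltrDl.
Qed.

Lemma total_eventually_const w s :
  total (concat w (const_point s)) =
  (birkhoff_sum rp (size w) (concat w (const_point s)))%:E.
Proof.
elim: w => [|x w IH].
  by rewrite concat_nil total_const /birkhoff_sum big_ord0.
by rewrite total_shift birkhoff_sumS shift_concat_cons IH.
Qed.

End deviation.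

(** * The large deviation principle *)

Section weight_rates.
Context {R : realType}.
Variables (coef : bool -> nat -> R) (z : R -> R).
Hypothesis coef_lt0 : forall s n, coef s n < 0.
Hypothesis coef_sum : forall s, cvgn (series (coef s)).
Hypothesis coef_kappa : forall s, coef s 0 <= kappa coef s.
Hypothesis z01 : forall b : R, 0 < b -> 0 < z b < 1.
Hypothesis z_eq : forall b : R, 0 < b ->
  boltz_sum coef b (z b) false * boltz_sum coef b (z b) true = 1.

Definition block_cost s r : R := kappa coef s - energy coef s r.+1.

Lemma rate_inner s r w : rate (fun b => gibbs_inner coef b (z b) s r w)
  (- dev_inner block_cost s r w).
Proof.
elim: w s r => [|x w IH] s r /=.
  by rewrite oppr0; exact: rate_block_tail.
case: eqP => _; first exact: IH.
rewrite opprD opprB; apply: rateM; [| |exact: rate_block_prob|exact: IH].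
  by apply: near_pos_of => b b0; apply: block_prob_gt0 => //; exact: z01.
apply: near_pos_of => b b0; have zb := z01 b0.
by apply: inner_gt0; [exact: block_prob_gt0|exact: block_tail_gt0].
Qed.

Lemma rate_outer s r w : rate (fun b => gibbs_outer coef b (z b) s r w)
  (rho coef - dev_outer block_cost (rho coef) s w).
Proof.
elim: w s r => [|x w IH] s r.
  by rewrite subr0; exact: rate_block_tail2.
rewrite /=; case: eqP => _; first exact: IH.
rewrite opprD addrA subrr; apply: rateM; [| |exact: rate_block_tail|exact: rate_inner].
  by apply: near_pos_of => b b0; apply: block_tail_gt0 => //; exact: z01.
apply: near_pos_of => b b0; have zb := z01 b0.
by apply: inner_gt0; [exact: block_prob_gt0|exact: block_tail_gt0].
Qed.

Lemma rate_weight w : rate (fun b => gibbs_weight coef b (z b) w)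
  (- dev block_cost (rho coef) w).
Proof.
case: w => [|x w].
  by have := rate_exp (0 : R); under eq_fun do rewrite mulr0 expR0; rewrite oppr0.
have V0 s : near_pos (fun b => block_tail2 coef b (z b) s 0).
  by apply: near_pos_of => b b0; apply: block_tail2_gt0 => //; exact: z01.
have per : rate (fun b => period (block_tail2 coef b (z b))) (rho coef).
  by apply: rateD => //; exact: rate_block_tail2.
rewrite (_ : - dev _ _ _ = (rho coef - dev_outer block_cost (rho coef) x w) - rho coef); last first.
  by rewrite /=; ring.
apply: rateM; [| |exact: rate_outer|exact: rateV].
  apply: near_pos_of => b b0; have zb := z01 b0.
  by apply: outer_gt0; [exact: block_prob_gt0|exact: block_tail_gt0|exact: block_tail2_gt0].
apply: near_posV; apply: near_pos_of => b b0; have zb := z01 b0.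
by apply: period_gt0; exact: block_tail2_gt0.
Qed.

End weight_rates.

Lemma sum_from {R : realType} (u v : nat -> R) k q : cvgn (series u) ->
  (forall i, v (k + i)%N = u (q + i)%N) -> \big[+%R/0]_(k <= j <oo) v j = tail u q.
Proof.
move=> cu vu; apply: cvg_lim => //; rewrite -(cvg_shiftn k) /=.
have := @cvg_tail _ u q cu; rewrite (_ : (fun n => _) = fun n => \sum_(k <= j < n + k) v j)//.
apply/funext => n; rewrite sub_series_geq ?leq_addr//.
have shiftE (w : nat -> R) m :
    \sum_(m <= i < n + m) w i = \sum_(0 <= i < n) w (m + i)%N.
  by rewrite -{1}[m]add0n big_addn addnK; apply: eq_bigr => i _; rewrite addnC.
by rewrite (addnC q) !shiftE; apply: eq_bigr => i _; rewrite vu.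
Qed.

(** By uniqueness of the equilibrium measure. *)
Lemma equilibrium_cylinder {R : realType} (f : shift_space -> R) coef
  (beta z : R) (theta : R) (mu : probability shift_space R) :
  0 < theta < 1 -> Lipschitz theta f ->
  (forall s n, coef s n < 0) ->
  (forall s n z, f (concat (rcons (nseq n.+1 s) (~~ s)) z) = coef s n) ->
  (forall s, f (const_point s) = 0) ->
  0 < beta -> 0 < z < 1 ->
  boltz_sum coef beta z false * boltz_sum coef beta z true = 1 ->
  equilibrium_measure (fun x => beta * f x) mu ->
  forall w, mu (cylinder w) = (gibbs_weight coef beta z w)%:E.
Proof.
move=> t01 lf coef_lt0 f_run f_const b0 z01 z1 [_ mu_unique] w.
have coef_sum s : cvgn (series (coef s)).
  exact: coef_summable t01 lf.
have [nu [inv nuE]] : exists nu : probability shift_space R,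
    shift_invariant nu /\ forall w, nu (cylinder w) = (gibbs_weight coef beta z w)%:E.
  apply: exists_renewal_measure.
  - exact: block_prob_gt0.
  - exact: block_tail_gt0.
  - exact: block_tail2_gt0.
  - exact: block_tail0.
  - exact: block_tailE.
  - exact: block_tail2E.
rewrite -(mu_unique nu) ?nuE//; last exact: measurable_cylinder.
have [C CP] := gibbs_weight_defect coef_lt0 coef_sum b0 z01 f_run f_const z1.
have f0 := f_le0 coef_lt0 f_run f_const.
have bg : bounded_measurable (fun x => beta * f x).
  apply: bounded_measurableZ; split; first exact: Lipschitz_measurable lf.
  exists (- energy_inf coef false - energy_inf coef true) => x.
  have := birkhoff_sum_block coef_lt0 f_run f_const coef_sum 1 (x 0%N) (shift_map x).
  rewrite concat_head_shift /birkhoff_sum big_ord1 /= ler_norml => /andP[lo hi].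
  have := energy_inf_lt0 coef_lt0 coef_sum false.
  have := energy_inf_lt0 coef_lt0 coef_sum true.
  by move: lo; case: (x 0%N) => *; apply/andP; split; lra.
apply: (@gibbs_attains_pressure _ _ _ (- ln z) C bg) => //.
- by move=> x; rewrite pmulr_rle0.
- by rewrite oppr_ge0 ln_le0//; case/andP: z01 => _ /ltW.
- by move=> v; rewrite nuE /=; exact: gibbs_weight_gt0.
- by move=> n x; rewrite nuE /=; exact: CP.
Qed.

Theorem theorem11 (R : realType) (theta : R) (theta01 : 0 < theta < 1)
  (f : shift_space -> R) (f_lip : Lipschitz theta f)
  (b d : R) (a c : nat -> R)
  (b_lt0 : b < 0) (d_lt0 : d < 0)
  (a_lt0 : forall n, (2 <= n)%N -> a n < 0)
  (c_lt0 : forall n, (2 <= n)%N -> c n < 0)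
  (f01 : forall x, cylinder [:: false; true] x -> f x = b)
  (f10 : forall x, cylinder [:: true; false] x -> f x = d)
  (f0 : f (const_point false) = 0) (f1 : f (const_point true) = 0)
  (fa : forall n, (2 <= n)%N ->
    forall x, cylinder (rcons (nseq n false) true) x -> f x = a n)
  (fc : forall n, (2 <= n)%N ->
    forall x, cylinder (rcons (nseq n true) false) x -> f x = c n)
  (mu : R -> probability shift_space R)
  (mu_eq : forall beta, 0 < beta ->
    equilibrium_measure (fun x => beta * f x) (mu beta))
  (hac : \big[+%R/0]_(2 <= j <oo) a j >= b + d + \big[+%R/0]_(2 <= j <oo) c j)
  (hca : \big[+%R/0]_(2 <= j <oo) c j >= b + d + \big[+%R/0]_(2 <= j <oo) a j)
  (U : shift_space -> R)
  (U0 : U (const_point false) = 0)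
  (U1 : U (const_point true) = b / 2 - d / 2
          + 2^-1 * \big[+%R/0]_(2 <= j <oo) a j
          - 2^-1 * \big[+%R/0]_(2 <= j <oo) c j)
  (U01 : forall q z, (1 <= q)%N ->
    U (concat (rcons (nseq q false) true) z) = \big[+%R/0]_(1 <= j <oo) a (q + j)%N)
  (U10 : forall q z, (1 <= q)%N ->
    U (concat (rcons (nseq q true) false) z) = b / 2 - d / 2
      + 2^-1 * \big[+%R/0]_(2 <= j <oo) a j
      - 2^-1 * \big[+%R/0]_(2 <= j <oo) c j
      + \big[+%R/0]_(1 <= j <oo) c (q + j)%N) :
  let I := Rplus_lim f U in
  [/\ large_deviation_principle mu I,
      I (const_point false) = 0%E, I (const_point true) = 0%E,
      forall (w : seq bool) (s : bool),
        I (concat w (const_point s)) = (Rplus_sum f U (size w) (concat w (const_point s)))%:E &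
      forall x, (forall (w : seq bool) (s : bool), x <> concat w (const_point s)) ->
        I x = +oo%E].
Proof.
pose coef (s : bool) (n : nat) : R :=
  if n is m.+1 then (if s then c else a) n.+1 else if s then d else b.
have coef_lt0 s n : coef s n < 0.
  by case: n => [|n]; case: s => //=; [exact: c_lt0|exact: a_lt0].
have f_run s n y : f (concat (rcons (nseq n.+1 s) (~~ s)) y) = coef s n.
  case: n => [|n]; case: s => /=.
  - by apply: f10; exists y.
  - by apply: f01; exists y.
  - by apply: (fc n.+2) => //; exists y.
  - by apply: (fa n.+2) => //; exists y.
have f_const s : f (const_point s) = 0 by case: s.
have coef_sum s : cvgn (series (coef s)).
  exact: coef_summable theta01 f_lip.
have tailE s q : tail (coef s) q = energy_inf coef s - energy coef s q by [].
have suma : \big[+%R/0]_(2 <= j <oo) a j = energy_inf coef false - b.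
  by rewrite (@sum_from _ (coef false) _ _ 1)// tailE energy1.
have sumc : \big[+%R/0]_(2 <= j <oo) c j = energy_inf coef true - d.
  by rewrite (@sum_from _ (coef true) _ _ 1)// tailE energy1.
have coef_kappa s : coef s 0 <= kappa coef s.
  by move: hac hca; rewrite suma sumc /kappa; case: s => /=; lra.
have /choice[z zP] : forall t : R, exists y : R, 0 < t -> 0 < y < 1 /\
    boltz_sum coef t y false * boltz_sum coef t y true = 1.
  move=> t.
  have [t0|t0] := ltP 0 t; last by exists 0.
  by have [y yP] := exists_pressure coef_lt0 coef_sum t0; exists y.
have z01 t : 0 < t -> 0 < z t < 1 by move=> /zP[].
have z_eq t : 0 < t -> boltz_sum coef t (z t) false * boltz_sum coef t (z t) true = 1.
  by move=> /zP[].
(* The additive constant of [U] on the points that begin with [s]. *)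
pose K s := if s then kappa coef false else 0.
have KN s : K (~~ s) = K s + kappa coef s.
  by rewrite /K; case: s => /=; rewrite ?add0r// -[true]/(~~ false) kappaN subrr.
have U_const s : U (const_point s) = K s.
  by case: s; rewrite /K ?U0// U1 suma sumc /kappa /=; lra.
(* Up to [K s], [U] is the sum of [f] over the points obtained by extending the
   first block to the left, one symbol at a time and forever. *)
have U_run s n y : U (concat (rcons (nseq n.+1 s) (~~ s)) y) =
    K s + energy_inf coef s - energy coef s n.+1.
  have sum_q u t : (forall i, u i.+2 = coef t i.+1) ->
      \big[+%R/0]_(1 <= j <oo) u (n.+1 + j)%N = tail (coef t) n.+1.
    by move=> uE; apply: sum_from => // i; rewrite addnA addn1 addSn uE.
  case: s.
    by rewrite [LHS](U10 n.+1 y)// suma sumc (sum_q _ true)// tailE /K /kappa /=; lra.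
  by rewrite [LHS](U01 n.+1 y)// (sum_q _ false)// tailE /= add0r.
(* [R_+] vanishes inside a block, where [f] is the increment of [U], ... *)
have rp_same s y : Rplus f U (concat [:: s; s] y) = 0.
  rewrite /Rplus shift_concat_cons.
  have [->|[k [y' ->]]] := const_or_run s y.
    rewrite -const_point_cons (concat_nseq_const 2) f_const U_const; lra.
  rewrite -!concat_cat (f_run s k.+1) (U_run s k.+1) (U_run s k).
  by rewrite [energy _ _ k.+2]energyS; lra.
(* ... and at a change of symbol it is the cost of the block that begins. *)
have rp_run s r y : Rplus f U (concat (~~ s :: rcons (nseq r.+1 s) (~~ s)) y) =
    block_cost coef s r.
  rewrite /Rplus shift_concat_cons (U_run s r).
  have -> : concat (~~ s :: rcons (nseq r.+1 s) (~~ s)) y =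
      concat (rcons (nseq 1 (~~ s)) (~~ ~~ s)) (concat (rcons (nseq r s) (~~ s)) y).
    by rewrite -concat_cat negbK.
  rewrite (f_run (~~ s) 0) (U_run (~~ s) 0) KN energy1 /block_cost.
  by rewrite /kappa; lra.
have rp_const s : Rplus f U (concat [:: ~~ s] (const_point s)) = rho coef.
  rewrite /Rplus shift_concat_cons concat_nil U_const.
  have -> : concat [:: ~~ s] (const_point s) =
      concat (rcons (nseq 1 (~~ s)) (~~ ~~ s)) (const_point s).
    by rewrite negbK [in LHS]const_point_cons -concat_cat.
  rewrite (f_run (~~ s) 0) (U_run (~~ s) 0) KN energy1.
  by have := kappaE coef (~~ s); rewrite kappaN; lra.
have energy_le1 s r : energy coef s r.+1 <= coef s 0.
  by rewrite -energy1; exact: energy_le.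
have cost_ge0 s r : 0 <= block_cost coef s r.
  by rewrite subr_ge0 (le_trans (energy_le1 s r)).
have rho_ge0 : 0 <= rho coef by exact/ltW/rho_gt0.
have gap_gt0 : 0 < - (coef false 0 + coef true 0).
  by have := coef_lt0 false 0; have := coef_lt0 true 0; lra.
have cost_gap s r t : - (coef false 0 + coef true 0) <=
    block_cost coef s r + block_cost coef (~~ s) t.
  rewrite /block_cost kappaN; have := energy_le1 s r; have := energy_le1 (~~ s) t.
  by case: s => /=; lra.
move=> I; have IE : I = total (Rplus f U) by [].
split.
- split.
  + by move=> x; rewrite IE; exact: (total_ge0 cost_ge0 rho_ge0 rp_same rp_run rp_const).
  + rewrite IE.
    exact: (total_lsc cost_ge0 rho_ge0 gap_gt0 cost_gap rp_same rp_run rp_const).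
  + move=> w; rewrite IE.
    rewrite (ereal_inf_total cost_ge0 rho_ge0 gap_gt0 cost_gap rp_same rp_run rp_const).
    have := rate_weight coef_lt0 coef_sum coef_kappa z01 z_eq w.
    have pos b' : 0 < b' -> 0 < gibbs_weight coef b' (z b') w.
      by move=> b0; apply: gibbs_weight_gt0 => //; exact: z01.
    move=> /(rate_lnP (near_pos_of pos)) lim.
    have ev : \forall t \near +oo, ((t^-1)%:E * lne (mu t (cylinder w)))%E =
        (t^-1 * ln (gibbs_weight coef t (z t) w))%:E.
      apply: filterS (near_pinfty_gt 0) => t t0.
      have -> : mu t (cylinder w) = (gibbs_weight coef t (z t) w)%:E.
        apply: (equilibrium_cylinder theta01 f_lip coef_lt0 f_run f_const) => //.
        - exact: z01.
        - exact: z_eq.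
        - exact: mu_eq.
      by rewrite lne_EFin// pos.
    rewrite -EFinN; apply/fine_cvgP; split; first by apply: filterS ev => t ->.
    apply: cvg_trans lim; apply: near_eq_cvg.
    by apply: filterS ev => t /= ->.
- exact: (total_const rp_same).
- exact: (total_const rp_same).
- move=> w s; rewrite IE.
  exact: (total_eventually_const cost_ge0 rho_ge0 rp_same rp_run rp_const).
- move=> x nx; rewrite IE.
  apply: (total_infinite cost_ge0 rho_ge0 gap_gt0 cost_gap rp_same rp_run rp_const).
  by case=> w [s xE]; exact: (nx w s).
Qed.
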